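(* Assume $\mathbb{E}[\phi_i^4]<\infty$ for $i=1,\dots,N$. Then $\widehat\Theta:=(\widehat H,\widehat\gamma^2,\widehat\sigma^2)^\top$ is a strongly consistent estimator of $\Theta=(H,\gamma^2,\sigma^2)^\top$, that is, $$\widehat\Theta\xrightarrow{\text{a.s.}}\Theta\quad\text{as } n\to\infty,\ \text{then } N\to\infty,$$ where $$\widehat H:=\frac12\log_2^+\!\left(\frac{\bar\zeta_{n,N}-4h^2\bar V_{n,N}}{\bar\eta_{n,N}-h^2\bar V_{n,N}}\right),\qquad \widehat\gamma^2:=\frac{\bar\eta_{n,N}-h^2\bar V_{n,N}}{h^{2\widehat H}\left(2^{2\widehat H-1}-1\right)},\qquad \widehat\sigma^2:=\frac{\bar\xi_{n,N}-h^2\bar V_{n,N}-\widehat\gamma^2h^{2\widehat H}}{h}.$$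
   Context: Model. Fix $\sigma>0$, $\gamma>0$, $H\in(\frac12,1)$ and a time step $h>0$. For $i=1,2,\dots$ let $B^i$ be standard Brownian motions and $B^{H,i}$ fractional Brownian motions with Hurst index $H$ (centered Gaussian, covariance $\frac12(t^{2H}+s^{2H}-|t-s|^{2H})$), all mutually independent, and set $M^{H,i}_t=\sigma B^i_t+\gamma B^{H,i}_t$. The random effects $\phi_1,\phi_2,\dots$ are i.i.d. real random variables, independent of the family $\{M^{H,i}\}$. Put $\theta_i=\phi_i-\frac{\sigma^2}{2}$ and $Y^i_t=\theta_it+M^{H,i}_t$ (so $X^i_t=e^{Y^i_t}$ solves $dX^i_t=\phi_iX^i_t\,dt+X^i_t\,dM^{H,i}_t$, $X^i_0=1$). Statistics. $\Delta Y^i_k:=Y^i_{(k+1)h}-Y^i_{kh}$, $\widehat\theta_i=\frac1{nh}\sum_{k=0}^{n-1}\Delta Y^i_k$, and $\xi^i_n=\frac1n\sum_{k=0}^{n-1}(\Delta Y^i_k)^2$, $\eta^i_n=\frac1n\sum_{k=0}^{n-1}\Delta Y^i_k\Delta Y^i_{k+1}$, $\zeta^i_n=\frac1n\sum_{k=0}^{n-1}(Y^i_{(k+2)h}-Y^i_{kh})(Y^i_{(k+4)h}-Y^i_{(k+2)h})$. Averages over $N$ subjects: $\bar V_{n,N}=\frac1N\sum_{i=1}^N\widehat\theta_i^2$, $\bar\xi_{n,N}=\frac1N\sum_{i=1}^N\xi^i_n$, $\bar\eta_{n,N}=\frac1N\sum_{i=1}^N\eta^i_n$, $\bar\zeta_{n,N}=\frac1N\sum_{i=1}^N\zeta^i_n$.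 Conventions. $\log_2^+(x):=\mathbf 1_{\{x>0\}}\log_2x$. The limit is sequential: first $n\to\infty$ with $N$ fixed, then $N\to\infty$. *)

(* Defs.v *)
From HB Require Import structures.
From mathcomp Require Import all_boot all_order all_algebra.
From mathcomp Require Import all_classical all_reals all_analysis.
Set Implicit Arguments.
Unset Strict Implicit.
Unset Printing Implicit Defensive.
Import Order.TTheory GRing.Theory Num.Theory.
Import numFieldNormedType.Exports.
Local Open Scope classical_set_scope.
Local Open Scope ring_scope.

Section Probability.
Context {d : measure_display} {T : measurableType d} {R : realType}.
Variable P : probability T R.

Definition sigma_generated {I : Type} (D : set I) (X : I -> T -> R) :
    set_system T :=
  <<s \bigcup_(i in D) preimage_set_system setT (X i) measurable >>.

Definition mutually_independent {J : eqType} (G : J -> set_system T) : Prop :=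
  forall (s : seq J) (A : J -> set T), uniq s ->
    (forall j, j \in s -> G j (A j)) ->
    P (\bigcap_(j in [set` s]) A j) = (\prod_(j <- s) P (A j))%E.

Definition independent (G1 G2 : set_system T) : Prop :=
  forall A1 A2, G1 A1 -> G2 A2 -> P (A1 `&` A2) = (P A1 * P A2)%E.

Definition mutually_independent_rv {J : eqType} (X : J -> T -> R) : Prop :=
  mutually_independent (fun j => sigma_generated [set j] X).

(* Only measurable sets are compared: [distribution] takes uncontrolled values
   on the other ones. *)
Definition identically_distributed {J : Type} (X : J -> {RV P >-> R}) : Prop :=
  forall i j (A : set R), measurable A ->
    distribution P (X i) A = distribution P (X j) A.

(* X has law N(m, s^2). The case s = 0 is the point mass at m; it is treated
   apart because [normal_prob m 0] is the uniform law on [0, 1]. *)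
Definition has_normal_law (m s : R) (X : T -> R) : Prop :=
  forall A : set R, measurable A ->
    P (X @^-1` A) = if s == 0 then dirac m A else normal_prob m s A.

Definition gaussian (X : T -> R) : Prop :=
  exists m s : R, 0 <= s /\ has_normal_law m s X.

(* Processes are indexed by R, but only the times t >= 0 are ever considered. *)

Definition gaussian_process (X : R -> {RV P >-> R}) : Prop :=
  forall (n : nat) (t a : 'I_n -> R), (forall k, 0 <= t k) ->
    gaussian (fun w => \sum_(k < n) a k * X (t k) w).

Definition independent_increments (X : R -> {RV P >-> R}) : Prop :=
  forall (n : nat) (t : nat -> R), 0 <= t 0%N ->
    {homo t : i j / (i <= j)%N >-> i <= j} ->
    mutually_independent_rv
      (fun (k : 'I_n) w => X (t k.+1) w - X (t k) w).

Definition standard_brownian_motion (B : R -> {RV P >-> R}) : Prop :=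
  [/\ {ae P, forall w, B 0 w = 0},
      independent_increments B,
      forall s t, 0 <= s -> s <= t ->
        has_normal_law 0 (Num.sqrt (t - s)) (fun w => B t w - B s w) &
      {ae P, forall w, {within `[0, +oo[, continuous (fun t => B t w)}}].

Definition fractional_brownian_motion (H : R) (X : R -> {RV P >-> R}) : Prop :=
  [/\ gaussian_process X,
      forall t, 0 <= t -> 'E_P[X t]%E = 0%E &
      forall s t, 0 <= s -> 0 <= t ->
        covariance P (X s) (X t) =
          ((t `^ (2 * H) + s `^ (2 * H) - `|t - s| `^ (2 * H)) / 2)%:E].

End Probability.

Section Model.
Context {d : measure_display} {T : measurableType d} {R : realType}.
Variables (P : probability T R) (sigma gamma : R).
Variables (phi : nat -> {RV P >-> R}) (B BH : nat -> R -> {RV P >-> R}).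

(* Subjects are numbered from 0. *)

Definition mixed_fbm (i : nat) (t : R) (w : T) : R :=
  sigma * B i t w + gamma * BH i t w.

Definition random_drift (i : nat) (w : T) : R := phi i w - sigma ^+ 2 / 2.

Definition observation (i : nat) (t : R) (w : T) : R :=
  random_drift i w * t + mixed_fbm i t w.

Definition driving_noise (j : nat + nat) : R -> T -> R :=
  match j with
  | inl i => fun t => B i t
  | inr i => fun t => BH i t
  end.

End Model.

Section Statistics.
Context {R : realType}.
Variable h : R.

Definition increment (y : R -> R) (k : nat) : R :=
  y (k.+1%:R * h) - y (k%:R * h).

Definition theta_hat (n : nat) (y : R -> R) : R :=
  (n%:R * h)^-1 * \sum_(0 <= k < n) increment y k.

Definition xi (n : nat) (y : R -> R) : R :=
  n%:R^-1 * \sum_(0 <= k < n) increment y k ^+ 2.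

Definition eta (n : nat) (y : R -> R) : R :=
  n%:R^-1 * \sum_(0 <= k < n) increment y k * increment y k.+1.

Definition zeta (n : nat) (y : R -> R) : R :=
  n%:R^-1 * \sum_(0 <= k < n)
    (y (k.+2%:R * h) - y (k%:R * h)) * (y (k.+4%:R * h) - y (k.+2%:R * h)).

Definition subject_mean (N : nat) (f : nat -> R) : R :=
  N%:R^-1 * \sum_(0 <= i < N) f i.

Definition log2_plus (x : R) : R := if 0 < x then ln x / ln 2 else 0.

(* y i is the observed path of subject i. Division is total, with x / 0 = 0. *)
Variables (y : nat -> R -> R) (n N : nat).

Definition V_bar : R := subject_mean N (fun i => theta_hat n (y i) ^+ 2).
Definition xi_bar : R := subject_mean N (fun i => xi n (y i)).
Definition eta_bar : R := subject_mean N (fun i => eta n (y i)).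
Definition zeta_bar : R := subject_mean N (fun i => zeta n (y i)).

Definition H_hat : R :=
  2^-1 * log2_plus ((zeta_bar - 4 * h ^+ 2 * V_bar)
                    / (eta_bar - h ^+ 2 * V_bar)).

Definition gamma2_hat : R :=
  (eta_bar - h ^+ 2 * V_bar)
  / (h `^ (2 * H_hat) * (2 `^ (2 * H_hat - 1) - 1)).

Definition sigma2_hat : R :=
  (xi_bar - h ^+ 2 * V_bar - gamma2_hat * h `^ (2 * H_hat)) / h.

Definition Theta_hat : R * R * R := (H_hat, gamma2_hat, sigma2_hat).

End Statistics.

(* u n N tends to l as n -> oo with N fixed, then N -> oo. The inner limits
   are required to exist for every N > 0. *)
Definition sequential_limit {U : topologicalType} (u : nat -> nat -> U) (l : U)
    : Prop :=
  exists v : nat -> U,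
    (forall N, (0 < N)%N -> (fun n => u n N) @ \oo --> v N) /\
    v @ \oo --> l.

(* Main.v *)
(** For fixed [N] the limit in [n] is already the true parameter, whatever the
    realized drifts are. Write [D_k^L] for the increment of the mixed process
    over the [L] grid steps starting at [k h]. Products of adjacent increments
    are polarized, [2 a b = (a + b)^2 - a^2 - b^2], so everything reduces to the
    strong law for [(D_k^L)^2] and for [D_k^L], where [L] is 1, 2 or 4.

    Strong law: if [Z_k >= 0] and the second moment of [sum_(k < n) (Z_k - c)] is
    [O(n^a)] with [a < 2], then along [n = m^p], [p] large, the second moments of
    the centred averages are summable, and monotonicity of the partial sums fills
    the gaps between consecutive [m^p].

    Second moment bound: let [rho_kl] be the covariance of [D_k^L] and [D_l^L].
    Isserlis' identity for fourth moments gives, for disjoint increments,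
    [cov((D_k^L)^2, (D_l^L)^2) = 2 rho_kl^2 <= 2 c rho_kl], because [rho_kl >= 0]
    by convexity of [x^(2H)]; for overlapping increments [rho_kl >= sigma^2 h], so
    any constant bound is again a multiple of [rho_kl]. Finally the [rho_kl] sum to
    the variance of [sum_k D_k^L], which telescopes and is [O(n^(2H))]. *)

From HB Require Import structures.
Require Import Defs.
From mathcomp Require Import all_boot all_order all_algebra.
From mathcomp Require Import all_classical all_reals all_analysis.
From mathcomp Require Import measurable_realfun ring lra.
Set Implicit Arguments.
Unset Strict Implicit.
Unset Printing Implicit Defensive.
Import Order.TTheory GRing.Theory Num.Theory.
Import numFieldNormedType.Exports.
Local Open Scope classical_set_scope.
Local Open Scope ring_scope.

(** * Moments of the normal law *)

Section NormalMoments.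
Context {R : realType}.
Notation mu := (@lebesgue_measure R).
Implicit Types (G g : R -> R) (m s x : R).

(** The Radon-Nikodym derivative of [normal_prob m s] and the function [normal_pdf m s] have the
    same integral over every measurable set, hence agree almost everywhere. *)
Lemma integral_normal_prob m s (f : R -> \bar R) : s != 0 ->
  measurable_fun setT f -> (forall x, 0 <= f x)%E ->
  (\int[normal_prob m s]_x f x = \int[mu]_x (f x * (normal_pdf m s x)%:E))%E.
Proof.
move=> s0 mf f0.
have dom := normal_prob_dominates m s.
rewrite -(Radon_Nikodym_SigmaFinite.change_of_variables dom)//.
apply: ae_eq_integral => //.
- apply: emeasurable_funM; first exact: mf.
  exact: measurable_int (Radon_Nikodym_SigmaFinite.f_integrable dom).
- apply: emeasurable_funM; first exact: mf.
  by apply/measurable_EFinP; exact: measurable_normal_pdf.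
- apply: ae_eqe_mul2l; apply: integral_ae_eq => //.
  + exact: Radon_Nikodym_SigmaFinite.f_integrable.
  + by apply/measurable_EFinP; exact: measurable_normal_pdf.
  + by move=> E _ mE; rewrite -(Radon_Nikodym_SigmaFinite.f_integral dom).
Qed.

Lemma derive1_affine m s : s != 0 ->
  ((fun x : R => (x - m) / s)^`())%classic = cst s^-1.
Proof.
move=> s0; apply/funext => x.
rewrite derive1E deriveM// deriveD// derive_cst scaler0.
by rewrite add0r derive_id derive_cst addr0 scaler1.
Qed.

(** Substitution by the increasing map [(x - m) / s], applied to the right-hand side; its derivative
    [1 / s] turns the peak of N(0, 1) into that of N(m, s^2). *)
Lemma integral_standardize m s G : 0 < s -> continuous G ->
  (forall x, 0 <= G x) ->
  (\int[mu]_x (G ((x - m) / s) * normal_pdf m s x)%:E =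
   \int[mu]_x (G x * normal_pdf 0 1 x)%:E)%E.
Proof.
move=> s0 cG G0.
have s0' : s != 0 by rewrite gt_eqF.
have dF := derive1_affine m s0'.
rewrite [RHS](@increasing_ge0_integration_by_substitutionT _
  (fun x => (x - m) / s) (fun x => G x * normal_pdf 0 1 x)); first last.
- by move=> x; rewrite mulr_ge0// normal_pdf_ge0.
- move=> x; apply: cvgM; first exact: cG.
  by apply: continuous_normal_pdf; rewrite oner_eq0.
- by apply/gt0_cvgMly; [rewrite invr_gt0|exact: cvg_addrr].
- by apply/gt0_cvgMlNy; [rewrite invr_gt0|exact: cvg_addrr_Ny].
- by move=> x; apply: derivableM => //; apply: derivableB.
- by rewrite dF; exact: is_cvg_cst.
- by rewrite dF; exact: is_cvg_cst.
- by rewrite dF => x; exact: cvg_cst.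
- by move=> x y xy; rewrite ltr_pM2r ?invr_gt0// ltrD2r.
apply: eq_integral => x _; rewrite dF !fctE -!mulrA; congr (_ * _)%:E.
rewrite !normal_pdfE ?oner_eq0// /normal_peak /normal_fun [RHS]mulrAC; congr (_ * _).
  rewrite expr1n mul1r -mulrnAr sqrtrM ?sqr_ge0// sqrtr_sqr gtr0_norm//.
  by rewrite invfM mulrC.
congr expR; rewrite subr0 expr1n.
by field.
Qed.

Lemma integralT_pos_neg G : continuous G -> (forall x, 0 <= G x) ->
  (\int[mu]_x (G x)%:E =
   \int[mu]_(x in `[0%R, +oo[) (G x)%:E + \int[mu]_(x in `[0%R, +oo[) (G (- x))%:E)%E.
Proof.
move=> cG G0.
have mG : measurable_fun [set: R] G by exact: continuous_measurable_fun.
rewrite -(setUv (`[0%R, +oo[%classic : set R)) ge0_integral_setU//=; last 4 first.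
- exact: measurableC.
- by apply/measurable_EFinP; rewrite setUv.
- by move=> x _; rewrite lee_fin.
- exact/disj_setPCl.
congr +%E; rewrite setCitvr.
rewrite integral_itv_bndo_bndc; last exact/measurable_EFinP/measurable_funTS.
rewrite -{1}oppr0 ge0_integration_by_substitutionNy//.
exact: continuous_subspaceT.
Qed.


Local Notation p := (normal_pdf (0:R) 1).
Local Notation C := (normal_peak (1:R) * expR (2^-1)).

Lemma std_normal_pdfE x : p x = normal_peak 1 * expR (- (x ^+ 2 / 2)).
Proof. by rewrite normal_pdfE ?oner_eq0// /normal_fun subr0 expr1n mulNr. Qed.

Lemma std_normal_pdfN x : p (- x) = p x.
Proof. by rewrite !std_normal_pdfE sqrrN. Qed.

(** From [(x - 1)^2 >= 0] follows [- x^2 / 2 <= 1 / 2 - x], which is the source of the factor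
    [expR (2^-1)] in [C]. *)
Lemma std_normal_pdf_le x : p x <= C * expR (- x).
Proof.
rewrite std_normal_pdfE -mulrA ler_wpM2l ?normal_peak_ge0// -expRD ler_expR.
have := sqr_ge0 (x - 1); nra.
Qed.

Lemma is_derive_std_normal_pdf x : is_derive x (1:R) p (- (x * p x)).
Proof.
have -> : p = fun x => normal_peak 1 * expR (- (x ^+ 2 / 2)).
  by apply/funext => y; exact: std_normal_pdfE.
apply: is_derive_eq.
rewrite /GRing.scale/=.
by field.
Qed.

(** Integration by parts: [p' = - x p] and the equation linking [A] to [a] give
    [(- A p)' = (a - b) p]. As [a - b] may change sign, while the fundamental theorem of calculus is
    applied on the half-line to non-negative functions, the term [b C exp(- x)] is added: it
    dominates [b p] and has integral [b C]. *)
Lemma halfline_moment (a A dA : R -> R) (b : R) :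
  (forall x, 0 <= a x) -> continuous a -> 0 <= b ->
  (forall x, is_derive x (1:R) A (dA x)) ->
  (forall x, dA x - x * A x = b - a x) ->
  A 0 = 0 -> A x * expR (- x) @[x --> +oo] --> (0:R) -> (forall x, 0 <= x -> 0 <= A x) ->
  (\int[mu]_(x in `[0%R, +oo[) (a x * p x)%:E =
   b%:E * \int[mu]_(x in `[0%R, +oo[) (p x)%:E)%E.
Proof.
move=> a0 ca b0 dAE AE A0 Alim Age0.
pose F x := - (A x * p x) - b * C * expR (- x).
pose f x := (a x - b) * p x + b * C * expR (- x).
have cp : continuous p by apply: continuous_normal_pdf; rewrite oner_eq0.
have cE : continuous (fun x : R => expR (- x)).
  by move=> x; apply: continuous_comp; [exact: continuousN|exact: continuous_expR].
have dF x : is_derive x (1:R) F (f x).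
  have := dAE x; have := is_derive_std_normal_pdf x => ? ?.
  rewrite /F /f; apply: is_derive_eq.
  rewrite /GRing.scale/=.
  have -> : a x = b - dA x + x * A x by have := AE x; lra.
  by ring.
have pe x : b * p x <= b * C * expR (- x).
  by rewrite -mulrA ler_wpM2l// std_normal_pdf_le.
have bC0 : 0 <= b * C by rewrite !mulr_ge0 ?normal_peak_ge0 ?expR_ge0.
have Elim : expR (- x) @[x --> +oo%R] --> (0:R) by exact: cvgr_expR.
have dE x : is_derive x (1:R) (fun x => - (b * C) * expR (- x)) (b * C * expR (- x)).
  by apply: is_derive_eq; rewrite /GRing.scale/=; ring.
have cf : continuous f.
  move=> x; apply: cvgD; last by apply: cvgM; [exact: cvg_cst|exact: cE].
  by apply: cvgM; [apply: cvgB; [exact: ca|exact: cvg_cst]|exact: cp].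
have If : (\int[mu]_(x in `[0%R, +oo[) (f x)%:E = (b * C)%:E)%E.
  rewrite (@ge0_continuous_FTC2y _ f F 0 0).
  - by rewrite -EFinB /F A0 mul0r oppr0 expR0; congr EFin; ring.
  - move=> x x0; rewrite /f mulrBl -addrA addr_ge0 ?mulr_ge0 ?normal_pdf_ge0//.
    by rewrite addrC subr_ge0.
  - exact: continuous_subspaceT.
  - rewrite /F -[X in _ --> X](subrr (0 : R)).
    apply: cvgB; last first.
      by rewrite -(mulr0 (b * C)); apply: cvgM => //; exact: cvg_cst.
    rewrite -[X in _ --> X]oppr0; apply: cvgN.
    apply: (@squeeze_cvgr _ _ _ _ (cst 0) (fun x => C * (A x * expR (- x)))).
    + near=> x.
      have Ax : 0 <= A x by apply: Age0; near: x; exact: nbhs_pinfty_ge.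
      rewrite mulr_ge0 ?normal_pdf_ge0//=.
      by have := ler_wpM2l Ax (std_normal_pdf_le x); rewrite mulrCA.
    + exact: cvg_cst.
    + by rewrite -(mulr0 C); apply: cvgM => //; exact: cvg_cst.
  - by move=> x _; have [] := dF x.
  - have [/derivable1_diffP/differentiable_continuous cF _] := dF 0.
    exact: cvg_at_right_filter.
  - by move=> x _; rewrite derive1E; have [] := dF x.
have IE : (\int[mu]_(x in `[0%R, +oo[) (b * C * expR (- x))%:E = (b * C)%:E)%E.
  rewrite (@ge0_continuous_FTC2y _ _ (fun x => - (b * C) * expR (- x)) 0 0).
  - by rewrite -EFinB oppr0 expR0; congr EFin; ring.
  - by move=> x _; rewrite mulr_ge0// expR_ge0.
  - apply: continuous_subspaceT => x.
    by apply: cvgM; [exact: cvg_cst|exact: cE].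
  - by rewrite -(mulr0 (- (b * C))); apply: cvgM => //; exact: cvg_cst.
  - by move=> x _; have [] := dE x.
  - have [/derivable1_diffP/differentiable_continuous cF _] := dE 0.
    exact: cvg_at_right_filter.
  - by move=> x _; rewrite derive1E; have [] := dE x.
have mE g : continuous g -> measurable_fun (`[0%R, +oo[%classic : set R) (EFin \o g).
  move=> cg; apply/measurable_EFinP; apply: measurable_funTS; exact: continuous_measurable_fun.
have cap : continuous (fun x => a x * p x).
  by move=> x; apply: cvgM; [exact: ca|exact: cp].
have cCE : continuous (fun x => b * C * expR (- x)).
  by move=> x; apply: cvgM; [exact: cvg_cst|exact: cE].
(* The integral of [a p] plus [b C] is regrouped as that of [f + b p], where [f] contributes [b C]
   again. *)
rewrite -[LHS](@addeK _ (b * C)%:E _)// -{1}IE -ge0_integralD//=; first last.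
- exact: (mE (fun x => b * C * expR (- x))).
- by move=> x _; rewrite lee_fin mulr_ge0// expR_ge0.
- exact: (mE (fun x => a x * p x)).
- by move=> x _; rewrite lee_fin mulr_ge0// normal_pdf_ge0.
under eq_integral => x _.
  rewrite -EFinD (_ : _ + _ = f x + b * p x); last by rewrite /f; ring.
  rewrite EFinD EFinM; over.
rewrite ge0_integralD//=; first last.
- apply: (mE (fun x => b * p x)) => x.
  by apply: cvgM; [exact: cvg_cst|exact: cp].
- by move=> x _; rewrite mule_ge0// lee_fin normal_pdf_ge0.
- exact: (mE f).
- move=> x _; rewrite lee_fin /f mulrBl -addrA addr_ge0//.
    by rewrite mulr_ge0// normal_pdf_ge0.
  by rewrite addrC subr_ge0.
rewrite If addeAC subee// add0e ge0_integralZl//.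
- exact: (mE p).
- by move=> x _; rewrite lee_fin normal_pdf_ge0.
Unshelve. all: by end_near. Qed.

(** Each half-line contributes [b] times the mass of [p] there, because [a] and [p] are even; the
    two masses add up to 1. *)
Lemma even_moment (a A dA : R -> R) (b : R) :
  (forall x, 0 <= a x) -> continuous a -> (forall x, a (- x) = a x) -> 0 <= b ->
  (forall x, is_derive x (1:R) A (dA x)) ->
  (forall x, dA x - x * A x = b - a x) ->
  A 0 = 0 -> A x * expR (- x) @[x --> +oo] --> (0:R) -> (forall x, 0 <= x -> 0 <= A x) ->
  (\int[mu]_x (a x * p x)%:E = b%:E)%E.
Proof.
move=> a0 ca aN b0 dAE AE A0 Alim Age0.
have cp : continuous p by apply: continuous_normal_pdf; rewrite oner_eq0.
have cap : continuous (fun x => a x * p x).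
  by move=> x; apply: cvgM; [exact: ca|exact: cp].
have p0 x : 0 <= p x by exact: normal_pdf_ge0.
rewrite integralT_pos_neg//; last by move=> x; rewrite mulr_ge0.
under [X in (_ + X)%E]eq_integral do rewrite aN std_normal_pdfN.
rewrite (halfline_moment a0 ca b0 dAE AE A0 Alim Age0) -ge0_muleDr; last 2 first.
- by apply: integral_ge0 => x _; rewrite lee_fin.
- by apply: integral_ge0 => x _; rewrite lee_fin.
have : (\int[mu]_x (p x)%:E = 1)%E by exact: integral_normal_pdf.
rewrite integralT_pos_neg//.
under [X in (_ + X)%E]eq_integral do rewrite std_normal_pdfN.
by move=> ->; rewrite mule1.
Qed.


(** For [x > 0], [exp x >= x^4 / 24], so that [x^3 exp(- x) <= 24 / x]. *)
Lemma cvg_cubic_expRN (A : R -> R) c : 0 <= c -> (forall x, 0 <= x -> 0 <= A x) ->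
  (forall x, 1 <= x -> A x <= c * x ^+ 3) -> A x * expR (- x) @[x --> +oo] --> (0:R).
Proof.
move=> c0 A0 Ac.
apply: (@squeeze_cvgr _ _ _ _ (cst 0) (fun x => c * 24 * x^-1)).
- near=> x.
  have x1 : 1 <= x by near: x; exact: nbhs_pinfty_ge.
  have x0 : 0 < x by exact: lt_le_trans x1.
  rewrite /cst mulr_ge0 ?expR_ge0 ?A0 ?(ltW x0)//= expRN.
  rewrite ler_pdivrMr ?expR_gt0// (le_trans (Ac _ x1))//.
  have -> : c * x ^+ 3 = c * 24 * x^-1 * (x ^+ 4 / 24) by field; rewrite gt_eqF.
  rewrite ler_wpM2l// ?mulr_ge0 ?invr_ge0 ?(ltW x0)//.
  by rewrite (le_trans _ (expR_ge1Dxn 3 (ltW x0)))// lerDr.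
- exact: cvg_cst.
- rewrite -(mulr0 (c * 24)); apply: cvgM; first exact: cvg_cst.
  by apply/(gtr0_cvgV0 _).2; [exact: nbhs_pinfty_gt|exact: cvg_id].
Unshelve. all: by end_near. Qed.

Lemma std_normal_moment2 : (\int[mu]_x (x ^+ 2 * p x)%:E = 1%:E)%E.
Proof.
(* [A = x] solves [A' - x A = 1 - x^2]. *)
apply: (@even_moment _ id (cst 1)) => //.
- by move=> x; exact: sqr_ge0.
- by move=> x; exact: exprn_continuous.
- by move=> x; rewrite sqrrN.
- apply: (@cvg_cubic_expRN _ 1) => // x x1.
  by rewrite mul1r exprS ler_peMr// ?(le_trans _ x1)// exprn_ege1.
Qed.

Lemma std_normal_moment4 : (\int[mu]_x (x ^+ 4 * p x)%:E = 3%:E)%E.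
Proof.
(* [A = x^3 + 3 x] solves [A' - x A = 3 - x^4]. *)
apply: (@even_moment _ (fun x => x ^+ 3 + 3 * x) (fun x => 3 * x ^+ 2 + 3)) => //.
- by move=> x; rewrite exprn_even_ge0.
- by move=> x; exact: exprn_continuous.
- by move=> x; ring.
- by move=> x; apply: is_derive_eq; rewrite /GRing.scale/=; ring.
- by move=> x; ring.
- by ring.
- apply: (@cvg_cubic_expRN _ 4) => // [x x0|x x1].
    by rewrite addr_ge0 ?mulr_ge0 ?exprn_ge0.
  have : x <= x ^+ 3 by rewrite exprS ler_peMr// ?(le_trans _ x1)// exprn_ege1.
  lra.
- by move=> x x0; rewrite addr_ge0 ?mulr_ge0 ?exprn_ge0.
Qed.

(** The vanishing of the first moment, phrased with positive and negative parts because integrals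
    are transported for non-negative integrands only. The reflection [x -> - x] exchanges the two
    sides. *)
Lemma std_normal_odd :
  (\int[mu]_x (Num.max x 0 * p x)%:E = \int[mu]_x (Num.max (- x) 0 * p x)%:E)%E.
Proof.
have cp : continuous p by apply: continuous_normal_pdf; rewrite oner_eq0.
have c1 : continuous (fun x : R => Num.max x 0).
  by move=> x; apply: continuous_max; [exact: cvg_id|exact: cvg_cst].
have c2 : continuous (fun x : R => Num.max (- x) 0).
  move=> x; apply: continuous_max; last exact: cvg_cst.
  exact: continuousN.
rewrite [LHS]integralT_pos_neg; first last.
- by move=> x; rewrite mulr_ge0 ?normal_pdf_ge0// le_max lexx orbT.
- by move=> x; apply: cvgM; [exact: c1|exact: cp].
rewrite [RHS]integralT_pos_neg; first last.
- by move=> x; rewrite mulr_ge0 ?normal_pdf_ge0// le_max lexx orbT.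
- by move=> x; apply: cvgM; [exact: c2|exact: cp].
rewrite addeC.
under eq_integral => x _ do rewrite std_normal_pdfN.
under [X in (_ = _ + X)%E]eq_integral => x _ do rewrite opprK std_normal_pdfN.
by [].
Qed.


(* [normal_prob] lives on the sigma-algebra of [measurableTypeR R], whose display
   differs from the one of R: the law is transported by hand. *)
Lemma ge0_integral_normal_law d (T : measurableType d) (P : probability T R)
    (X : T -> R) m s (f : R -> \bar R) : measurable_fun setT X ->
  0 < s -> has_normal_law P m s X ->
  measurable_fun setT f -> (forall y, 0 <= f y)%E ->
  (\int[P]_w f (X w) = \int[normal_prob m s]_x f x)%E.
Proof.
move=> mX s0 Xlaw mf f0.
have mX' : @measurable_fun _ _ T (measurableTypeR R) setT X by exact: mX.
pose Y : {RV P >-> measurableTypeR R} :=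
  HB.pack (X : T -> R) (isMeasurableFun.Build _ _ _ _ _ mX').
transitivity (\int[distribution P Y]_x f x)%E.
  by symmetry; apply: (@ge0_integral_distribution _ _ T (measurableTypeR R)).
by apply: eq_measure_integral => A mA _; have := Xlaw A mA; rewrite gt_eqF.
Qed.

Lemma normal_law_integral d (T : measurableType d) (P : probability T R)
    (X : T -> R) m s G : measurable_fun setT X -> 0 < s -> has_normal_law P m s X ->
  continuous G -> (forall x, 0 <= G x) ->
  (\int[P]_w (G ((X w - m) / s))%:E = \int[mu]_x (G x * p x)%:E)%E.
Proof.
move=> mX s0 Xlaw cG G0.
have mGF : measurable_fun [set: R] (fun x => G ((x - m) / s)).
  apply: continuous_measurable_fun => x.
  apply: (@continuous_comp _ _ _ (fun x => (x - m) / s) G); last exact: cG.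
  by apply: cvgM; [apply: cvgB; [exact: cvg_id|exact: cvg_cst]|exact: cvg_cst].
rewrite -(integral_standardize m s0 cG G0).
rewrite (ge0_integral_normal_law (f := fun x => (G ((x - m) / s))%:E) mX s0 Xlaw).
- rewrite integral_normal_prob ?gt_eqF//; last by move=> x; rewrite lee_fin.
  exact/measurable_EFinP.
- exact/measurable_EFinP.
- by move=> y; rewrite lee_fin.
Qed.

End NormalMoments.

(** * Moments up to order four on a probability space *)

Section Moments.
Context {d : measure_display} {T : measurableType d} {R : realType}.
Variable P : probability T R.
Implicit Types (X Y Z W f g : T -> R) (a b c : R).

Local Notation E f := (Rintegral P setT f).
Local Notation itg f := (P.-integrable setT (EFin \o f)).

(** A space closed under linear combinations in which products of at most four members are
    integrable; this covers covariances of squares. *)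
Definition L4 X := measurable_fun setT X /\ itg (fun w => X w ^+ 4).

(* Expectations of polynomials in several variables are expanded by exhibiting
   the polynomial as [lincomb s] for an explicit list [s] of (coefficient,
   integrable monomial). *)
Fixpoint lincomb (s : seq (R * (T -> R))) (w : T) : R :=
  if s is (c, f) :: s' then c * f w + lincomb s' w else 0.

Fixpoint lincomb_integrable (s : seq (R * (T -> R))) : Prop :=
  if s is (c, f) :: s' then itg f /\ lincomb_integrable s' else True.

Fixpoint lincomb_mean (s : seq (R * (T -> R))) : R :=
  if s is (c, f) :: s' then c * E f + lincomb_mean s' else 0.

Lemma itgZ c f : itg f -> itg (fun w => c * f w).
Proof.
move=> fi; have := integrableZl measurableT c fi.
by apply: eq_integrable => // w _ /=; rewrite EFinM.
Qed.

Lemma itgD f g : itg f -> itg g -> itg (fun w => f w + g w).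
Proof.
move=> fi gi; have := integrableD measurableT fi gi.
by apply: eq_integrable => // w _ /=; rewrite EFinD.
Qed.

Lemma integrable_lincomb s : lincomb_integrable s -> itg (lincomb s).
Proof.
elim: s => [_|[c f] s IH /= [fi si]]; first exact: integrable0.
by apply: itgD; [exact: itgZ|exact: IH].
Qed.

Lemma mean_lincomb s : lincomb_integrable s -> E (lincomb s) = lincomb_mean s.
Proof.
elim: s => [_|[c f] s IH /= [fi si]].
  by rewrite /= Rintegral_cst// mul0r.
rewrite RintegralD//; last exact: integrable_lincomb.
  by rewrite RintegralZl// IH.
exact: itgZ.
Qed.

Lemma mean_sum n (f : nat -> T -> R) : (forall k, itg (f k)) ->
  itg (fun w => \sum_(k < n) f k w) /\
  \int[P]_w (\sum_(k < n) f k w) = \sum_(k < n) E (f k).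
Proof.
move=> fi; elim: n => [|n [IH1 IH2]].
  split; last first.
    by under eq_Rintegral do rewrite big_ord0; rewrite Rintegral_cst// mul0r big_ord0.
  by under eq_fun do rewrite big_ord0; exact: integrable0.
have -> : (fun w => \sum_(k < n.+1) f k w) = (fun w => \sum_(k < n) f k w + f n w).
  by apply/funext => w; rewrite big_ord_recr.
split; first exact: itgD.
by rewrite RintegralD// IH2 big_ord_recr.
Qed.

Lemma le_itg f g : measurable_fun setT f -> (forall w, `|f w| <= g w) -> itg g ->
  itg f.
Proof.
move=> mf fg gi; apply: (le_integrable measurableT _ _ gi).
  exact/measurable_EFinP.
by move=> w _ /=; rewrite lee_fin (le_trans (fg w))// ler_norm.
Qed.

Lemma L4_cst c : L4 (cst c).
Proof.
split; first exact: measurable_cst.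
exact: (finite_measure_integrable_cst P (c ^+ 4) measurableT).
Qed.

(** Applying [2 u v <= u^2 + v^2] twice bounds the absolute value of the product by a quarter of the
    sum of the fourth powers. *)
Lemma L4_prod4 X Y Z W : L4 X -> L4 Y -> L4 Z -> L4 W ->
  itg (fun w => X w * Y w * Z w * W w).
Proof.
move=> [mX iX] [mY iY] [mZ iZ] [mW iW].
apply: (@le_itg _ (lincomb [:: (1, fun w => X w ^+ 4); (1, fun w => Y w ^+ 4);
   (1, fun w => Z w ^+ 4); (1, fun w => W w ^+ 4)])).
- by do !apply: measurable_funM.
- move=> w /=; rewrite !mul1r addr0 !normrM.
  have H4 (u : R) : u ^+ 4 = `|u| ^+ 4 by rewrite -normrX ger0_norm// exprn_even_ge0.
  rewrite (H4 (X w)) (H4 (Y w)) (H4 (Z w)) (H4 (W w)).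
  move: `|X w| `|Y w| `|Z w| `|W w| => x y z t.
  have Hm (u v : R) : u * v <= (u ^+ 2 + v ^+ 2) / 2 by have := sqr_ge0 (u - v); nra.
  have := Hm (x * y) (z * t); have := Hm (x ^+ 2) (y ^+ 2); have := Hm (z ^+ 2) (t ^+ 2).
  have := sqr_ge0 (x^+2); have := sqr_ge0 (y^+2).
  have := sqr_ge0 (z^+2); have := sqr_ge0 (t^+2).
  rewrite -!exprM !exprMn -!mulrA.
  lra.
- exact: integrable_lincomb.
Qed.

Lemma L4_prod3 X Y Z : L4 X -> L4 Y -> L4 Z -> itg (fun w => X w * Y w * Z w).
Proof.
move=> hX hY hZ; have := L4_prod4 hX hY hZ (L4_cst 1).
by under eq_fun do rewrite mulr1.
Qed.

Lemma L4_prod2 X Y : L4 X -> L4 Y -> itg (fun w => X w * Y w).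
Proof.
move=> hX hY; have := L4_prod3 hX hY (L4_cst 1).
by under eq_fun do rewrite mulr1.
Qed.

Lemma L4_itg X : L4 X -> itg X.
Proof.
move=> hX; have := L4_prod2 hX (L4_cst 1).
by under eq_fun do rewrite mulr1.
Qed.

Lemma L4Z c X : L4 X -> L4 (fun w => c * X w).
Proof.
move=> [mX iX]; split; first exact: measurable_funM.
under eq_fun do rewrite exprMn.
exact: itgZ.
Qed.

Lemma L4D X Y : L4 X -> L4 Y -> L4 (fun w => X w + Y w).
Proof.
move=> [mX iX] [mY iY]; split; first exact: measurable_funD.
apply: (@le_itg _ (lincomb [:: (8, fun w => X w ^+ 4); (8, fun w => Y w ^+ 4)])).
- by apply: measurable_funX; exact: measurable_funD.
- move=> w /=; rewrite addr0 ger0_norm ?exprn_even_ge0//.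
  move: (X w) (Y w) => x y; have := sqr_ge0 (x - y); have := sqr_ge0 (x ^+ 2 - y ^+ 2).
  have := sqr_ge0 (x + y). nra.
- exact: integrable_lincomb.
Qed.

Lemma L4B X Y : L4 X -> L4 Y -> L4 (fun w => X w - Y w).
Proof.
move=> hX hY; have := L4D hX (L4Z (-1) hY).
by under eq_fun do rewrite mulN1r.
Qed.

Lemma ge0_mean f c : measurable_fun setT f -> (forall w, 0 <= f w) ->
  (\int[P]_w (f w)%:E = c%:E)%E -> itg f /\ E f = c.
Proof.
move=> mf f0 fc; split; last by rewrite /Rintegral fc.
apply/integrableP; split; first exact/measurable_EFinP.
under eq_integral do rewrite /= ger0_norm//.
by rewrite fc ltry.
Qed.

Lemma mean_cst c : E (cst c) = c.
Proof.
rewrite Rintegral_cst// -[RHS]mulr1; congr (c * _).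
by have /(congr1 fine) := probability_setT P.
Qed.

Lemma max_pos_neg (x : R) : x = Num.max x 0 - Num.max (- x) 0.
Proof.
have [x0|x0] := leP 0 x.
  by rewrite max_r ?subr0// oppr_le0.
by rewrite max_l ?sub0r ?opprK// oppr_ge0 ltW.
Qed.

Lemma standardized_moments X m s : measurable_fun setT X -> 0 < s ->
  has_normal_law P m s X ->
  let Z w := (X w - m) / s in
  [/\ L4 Z, E Z = 0, E (fun w => Z w ^+ 2) = 1 & E (fun w => Z w ^+ 4) = 3].
Proof.
move=> mX s0 Xlaw Z.
have mZ : measurable_fun setT Z by apply: measurable_funM => //; exact: measurable_funB.
have NL := fun G cG G0 => @normal_law_integral R d T P X m s G mX s0 Xlaw cG G0.
have [i4 e4] : itg (fun w => Z w ^+ 4) /\ E (fun w => Z w ^+ 4) = 3.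
  apply: ge0_mean; first exact: measurable_funX.
    by move=> w; rewrite exprn_even_ge0.
  rewrite -std_normal_moment4 (NL (fun x => x ^+ 4))// => [x|x].
    exact: exprn_continuous.
  by rewrite exprn_even_ge0.
have LZ : L4 Z by split.
split=> //.
- have cmax (f : R -> R) : continuous f -> continuous (fun x : R => Num.max (f x) 0).
    by move=> cf x; apply: continuous_max; [exact: cf|exact: cvg_cst].
  have mmax (f : T -> R) : measurable_fun setT f ->
      measurable_fun setT (fun w => Num.max (f w) 0).
    by move=> mf; exact: measurable_maxr.
  have mZN : measurable_fun setT (fun w => - Z w) by exact: measurableT_comp.
  have imax (f : T -> R) : measurable_fun setT f -> (forall w, `|f w| = `|Z w|) ->
      itg (fun w => Num.max (f w) 0).
    move=> mf fZ; apply: (@le_itg _ (fun w => `|Z w|)); first exact: mmax.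
      move=> w; rewrite -fZ; have [f0|f0] := leP 0 (f w); first by rewrite ger0_norm.
      by rewrite normr0.
    by apply: integrable_norm => //; exact: L4_itg.
  rewrite (_ : Z = fun w => Num.max (Z w) 0 - Num.max (- Z w) 0); last first.
    by apply/funext => w; exact: max_pos_neg.
  rewrite RintegralB//; last 2 first.
  + by apply: imax.
  + by apply: imax => // w; rewrite normrN.
  apply/eqP; rewrite subr_eq0; apply/eqP; rewrite /Rintegral; congr fine.
  rewrite (NL (fun x => Num.max x 0)); last 2 first.
  + by apply: (cmax id) => x; exact: cvg_id.
  + by move=> x; rewrite le_max lexx orbT.
  rewrite (NL (fun x => Num.max (- x) 0)); last 2 first.
  + by apply: (cmax -%R) => x; exact: continuousN.
  + by move=> x; rewrite le_max lexx orbT.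
  exact: std_normal_odd.
- apply: (ge0_mean _ _ _).2; first exact: measurable_funX.
    by move=> w; exact: sqr_ge0.
  rewrite -std_normal_moment2 (NL (fun x => x ^+ 2))// => [x|x].
    exact: exprn_continuous.
  exact: sqr_ge0.
Qed.

Lemma normal_law_moments X m s : measurable_fun setT X -> 0 <= s ->
  has_normal_law P m s X ->
  [/\ L4 X, E X = m & m = 0 ->
    E (fun w => X w ^+ 2) = s ^+ 2 /\ E (fun w => X w ^+ 4) = 3 * s ^+ 4].
Proof.
(* If [s = 0], the law is the point mass at [m]: then [X = m] almost surely and each integral is a
   value at [m]. Otherwise [X] is an affine image of its standardization [Z]. *)
move=> mX; rewrite le_eqVlt => /predU1P[<-|s0] Xlaw.
  have m1 : measurable (~` [set m]) by apply: measurableC; exact: measurable_set1.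
  have P0 : P (X @^-1` ~` [set m]) = 0%E.
    by have := Xlaw _ m1; rewrite eqxx /dirac => ->; rewrite indicE memNset//=; apply.
  have Xm : {ae P, forall w, X w = m}.
    exists (X @^-1` ~` [set m]); split=> //.
    by rewrite -[X in measurable X]setTI; exact: mX.
  have Ef (f : R -> R) : measurable_fun setT (f \o X) ->
      (\int[P]_w (f (X w))%:E = (f m)%:E)%E.
    move=> mf; rewrite (ae_eq_integral (cst (f m)%:E))//.
    - by rewrite integral_cst// -[RHS]mule1; congr (_ * _)%E; exact: probability_setT.
    - exact/measurable_EFinP.
    - by apply: filterS Xm => w -> _.
  have i4 : itg (fun w => X w ^+ 4).
    apply: (ge0_mean (c := m ^+ 4) _ _ _).1; first exact: measurable_funX.
      by move=> w; rewrite exprn_even_ge0.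
    by apply: (Ef (fun x => x ^+ 4)); exact: measurable_funX.
  split; first by split.
    by rewrite /Rintegral (Ef id).
  move=> m0; split; rewrite expr0n ?mulr0 /Rintegral.
    by rewrite (Ef (fun x => x ^+ 2)) ?m0 ?expr0n//; exact: measurable_funX.
  by rewrite (Ef (fun x => x ^+ 4)) ?m0 ?expr0n//; exact: measurable_funX.
have [LZ Z1 Z2 Z4] := standardized_moments mX s0 Xlaw.
set Z := fun w => (X w - m) / s in LZ Z1 Z2 Z4.
have XE : X = fun w => s * Z w + cst m w.
  by apply/funext => w; rewrite /Z /cst; field; rewrite gt_eqF.
have LX : L4 X by rewrite XE; apply: L4D; [exact: L4Z|exact: L4_cst].
split=> //.
  rewrite XE RintegralD//; last 2 first.
  - by apply: itgZ; exact: L4_itg.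
  - by apply: L4_itg; exact: L4_cst.
  by rewrite RintegralZl ?Z1 ?mulr0 ?add0r ?mean_cst//; exact: L4_itg.
move=> m0; rewrite XE m0.
have i2 : itg (fun w => Z w ^+ 2) by have := L4_prod2 LZ LZ; under eq_fun do rewrite -expr2.
have i4 := LZ.2.
split.
  under eq_Rintegral => w _ do rewrite /cst addr0 exprMn.
  by rewrite RintegralZl// Z2 mulr1.
under eq_Rintegral => w _ do rewrite /cst addr0 exprMn.
by rewrite RintegralZl// Z4 mulrC.
Qed.
End Moments.

(** * Independence *)

Section Independence.
Context {d : measure_display} {T : measurableType d} {R : realType}.
Variable P : probability T R.
Implicit Types (U V : set_system T) (f g : T -> R).

Local Notation E f := (Rintegral P setT f).
Local Notation itg f := (P.-integrable setT (EFin \o f)).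

(** The joint law of [(f, g)] agrees with the product of the marginal laws on rectangles, hence on
    all measurable sets; Fubini's theorem then factors the integral of [x y]. *)
Lemma integral_independent (f g : T -> R) :
  measurable_fun setT f -> measurable_fun setT g ->
  (forall A B : set R, measurable A -> measurable B ->
     P (f @^-1` A `&` g @^-1` B) = (P (f @^-1` A) * P (g @^-1` B))%E) ->
  itg f -> itg g -> itg (fun w => f w * g w) ->
  E (fun w => f w * g w) = E f * E g.
Proof.
move=> mf mg ind fi gi fgi.
pose F : {mfun T >-> R} := HB.pack f (isMeasurableFun.Build _ _ _ _ _ mf).
pose G : {mfun T >-> R} := HB.pack g (isMeasurableFun.Build _ _ _ _ _ mg).
have mFG : measurable_fun setT (fun w => (F w, G w)) by exact: measurable_fun_pair.
pose FG : {mfun T >-> (R * R)%type} := HB.pack (fun w => (F w, G w)) (isMeasurableFun.Build _ _ _ _ _ mFG).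
pose m1 := distribution P F; pose m2 := distribution P G.
pose m12 := distribution P FG.
have prodE (X : set (R * R)) : measurable X -> (m1 \x m2)%E X = m12 X.
  apply: product_measure_unique => A B mA mB.
  by rewrite /m12 /m1 /m2 /= /distribution /pushforward/= -ind.
pose h (z : R * R) := (z.1 * z.2)%:E.
have mh : measurable_fun setT h.
  by apply/measurable_EFinP; apply: measurable_funM; [exact: measurable_fst|exact: measurable_snd].
have hi : (m1 \x m2)%E.-integrable setT h.
  apply/integrableP; split; first exact: mh.
  rewrite (eq_measure_integral m12); last by move=> A mA _; exact: prodE.
  have /integrableP[_] := integrable_pushforward mFG mh fgi measurableT.
  exact.
have E1 : (\int[m1 \x m2]_z h z = \int[P]_w (f w * g w)%:E)%E.
  rewrite (eq_measure_integral m12); last by move=> A mA _; exact: prodE.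
  exact: (integral_pushforward mFG mh fgi measurableT).
have mid : measurable_fun [set: R] (fun x : R => x%:E) by exact/measurable_EFinP.
have I1 : (\int[m1]_x x%:E = (E f)%:E)%E.
  rewrite (integral_pushforward mf mid fi measurableT) /Rintegral fineK//.
  exact: integrable_fin_num.
have I2 : (\int[m2]_x x%:E = (E g)%:E)%E.
  rewrite (integral_pushforward mg mid gi measurableT) /Rintegral fineK//.
  exact: integrable_fin_num.
have i1 : m1.-integrable setT (fun x : R => x%:E).
  exact: (integrable_pushforward mf mid fi measurableT).
have i2 : m2.-integrable setT (fun x : R => x%:E).
  exact: (integrable_pushforward mg mid gi measurableT).
apply: EFin_inj; rewrite EFinM -I1 -I2.
transitivity (\int[P]_w (f w * g w)%:E)%E.
  by rewrite /Rintegral fineK//; exact: integrable_fin_num.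
rewrite -E1 -integral12_prod_meas1//.
under eq_integral => x _.
  rewrite /fubini_F /h/=.
  under eq_integral do rewrite EFinM.
  rewrite integralZl//.
  over.
by rewrite I2 integralZr// I1.
Qed.

Lemma sigma_measurable_preimage U f : 
  measurable_fun (T := g_sigma_algebraType U) setT f ->
  forall A : set R, measurable A -> <<s U>> (f @^-1` A).
Proof. by move=> mf A mA; rewrite -[X in <<s _>> X]setTI; exact: mf. Qed.

Lemma mean_independent U V f g : independent P <<s U>> <<s V>> ->
  measurable_fun (T := g_sigma_algebraType U) setT f ->
  measurable_fun (T := g_sigma_algebraType V) setT g ->
  measurable_fun setT f -> measurable_fun setT g ->
  itg f -> itg g -> itg (fun w => f w * g w) ->
  E (fun w => f w * g w) = E f * E g.
Proof.
move=> UV fU gV mf mg; apply: integral_independent => // A B mA mB.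
by apply: UV; exact: sigma_measurable_preimage.
Qed.

Lemma sigma_generated_measurable (I : Type) (D : set I) (X : I -> T -> R) i :
  D i -> measurable_fun (T := g_sigma_algebraType
    (\bigcup_(i in D) preimage_set_system setT (X i) measurable)) setT (X i).
Proof.
move=> Di _ A mA; apply: sub_sigma_algebra; exists i => //.
by exists A.
Qed.

End Independence.

(** * Strong law for non-negative variables *)

Section Sandwich.
Context {R : realType}.
Implicit Types (S : nat -> R) (c : R).

(** The integer part of the [p]-th root of [n]. For [p > 0] the range [i <= n] loses no candidate,
    since [i <= i^p]. *)
Definition root_floor (p n : nat) : nat := \max_(i < n.+1 | (i ^ p <= n)%N) i.

Lemma root_floorP p n : (0 < p)%N ->
  (root_floor p n ^ p <= n < (root_floor p n).+1 ^ p)%N.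
Proof.
move=> p0; apply/andP; split.
  rewrite /root_floor; elim/big_ind: _ => //= [|i j].
    by rewrite exp0n.
  by rewrite /maxn; case: ifP.
rewrite ltnNge; apply/negP => rn.
have rlt : ((root_floor p n).+1 < n.+1)%N.
  by rewrite ltnS (leq_trans _ rn)// -[leqLHS]expn1 leq_pexp2l.
have := @leq_bigmax_cond _ (fun i : 'I_n.+1 => (i ^ p <= n)%N) (fun i => val i)
  (Ordinal rlt) rn.
by rewrite -/(root_floor p n) /= ltnn.
Qed.

Lemma root_floor_infty p : (0 < p)%N -> root_floor p n @[n --> \oo] --> \oo.
Proof.
move=> p0 A [N _ NA]; exists (N ^ p)%N => // n /= Nn; apply: NA => /=.
have /andP[_] := root_floorP n p0.
by move=> /(leq_ltn_trans Nn); rewrite ltn_exp2r// ltnS.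
Qed.

Lemma cvg_ratio_power p :
  ((m%:R / m.+1%:R) ^+ p : R) @[m --> \oo] --> (1 : R).
Proof.
have H : (m%:R / m.+1%:R : R) @[m --> \oo] --> (1 : R).
  have -> : (fun m : nat => m%:R / m.+1%:R : R) = (fun m => 1 - harmonic m).
    by apply/funext => m; rewrite /harmonic/= -[m.+1%:R]natr1; field; rewrite natr1 pnatr_eq0.
  rewrite -[X in _ --> X]subr0; apply: cvgB; first exact: cvg_cst.
  exact: cvg_harmonic.
have := cvg_comp _ _ H (@exprn_continuous _ p 1).
by rewrite expr1n.
Qed.

(** With [r] the integer part of the [p]-th root of [n], monotonicity gives [S (r^p) / (r+1)^p <= S
    n / n <= S ((r+1)^p) / r^p]. Both bounds are averages at a [p]-th power, up to the factor
    [(r / (r+1))^p] or its inverse, which tends to 1. *)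
Lemma cvg_mean_subseq S c p : (0 < p)%N ->
  {homo S : m n / (m <= n)%N >-> m <= n} -> 0 <= S 0%N ->
  S (m ^ p)%N / (m ^ p)%:R @[m --> \oo] --> c ->
  S n / n%:R @[n --> \oo] --> c.
Proof.
move=> p0 Smon S0 Sc.
have Sge0 n : 0 <= S n by rewrite (le_trans S0)// Smon.
pose u m := S (m ^ p)%N / (m ^ p)%:R; pose q m : R := (m%:R / m.+1%:R) ^+ p.
have rinf := root_floor_infty p0.
have rpos : \forall n \near \oo, (0 < root_floor p n)%N.
  by apply: (rinf [set m | (0 < m)%N]); exists 1%N.
have L1 : (u m * q m) @[m --> \oo] --> c.
  by rewrite -[X in _ --> X]mulr1; apply: cvgM => //; exact: cvg_ratio_power.
have L2 : (u m.+1 / q m) @[m --> \oo] --> c.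
  rewrite -[X in _ --> X]mulr1 -[X in _ * X]invr1; apply: cvgM.
    by rewrite (cvg_shiftS u).
  by apply: cvgV; [exact: oner_neq0|exact: cvg_ratio_power].
apply: (squeeze_cvgr _ (cvg_comp _ _ rinf L1) (cvg_comp _ _ rinf L2)).
near=> n.
have n1 : (1 <= n)%N by near: n; exact: nbhs_infty_ge.
have /andP[rn nr] := root_floorP n p0.
have r1 : (0 < root_floor p n)%N by near: n; exact: rpos.
rewrite /comp /u /q; set r := root_floor p n in rn nr r1 *.
have rp : 0 < (r ^ p)%:R :> R by rewrite ltr0n expn_gt0 r1.
have n0 : 0 < n%:R :> R by rewrite ltr0n.
have rp1 : 0 < (r.+1 ^ p)%:R :> R by rewrite ltr0n expn_gt0.
have -> : (r%:R / r.+1%:R) ^+ p = (r ^ p)%:R / (r.+1 ^ p)%:R :> R by rewrite expr_div_n !natrX.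
have -> : S (r ^ p)%N / (r ^ p)%:R * ((r ^ p)%:R / (r.+1 ^ p)%:R) = S (r ^ p)%N / (r.+1 ^ p)%:R.
  by field; rewrite !gt_eqF.
have -> : S (r.+1 ^ p)%N / (r.+1 ^ p)%:R / ((r ^ p)%:R / (r.+1 ^ p)%:R) = S (r.+1 ^ p)%N / (r ^ p)%:R.
  by field; rewrite !gt_eqF.
apply/andP; split.
  apply: ler_pM; [exact: Sge0|by rewrite invr_ge0|exact: Smon|].
  by rewrite lef_pV2 ?posrE// ler_nat ltnW.
apply: ler_pM; [exact: Sge0|by rewrite invr_ge0|exact/Smon/ltnW|].
by rewrite lef_pV2 ?posrE// ler_nat.
Unshelve. all: by end_near. Qed.

Lemma sum_inv_sqr_le2 n : \sum_(0 <= m < n) ((m.+1)%:R ^+ 2)^-1 <= 2 :> R.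
Proof.
(* The induction needs this sharper bound; with [a = n + 1], its slack in the inductive step is
   [1 / (a (a+1)^2)]. *)
suff : \sum_(0 <= m < n.+1) ((m.+1)%:R ^+ 2)^-1 <= 2 - (n.+1)%:R^-1 :> R.
  move=> H; have : \sum_(0 <= m < n) ((m.+1)%:R ^+ 2)^-1 <= \sum_(0 <= m < n.+1) ((m.+1)%:R ^+ 2)^-1 :> R.
    by rewrite big_nat_recr//= lerDl invr_ge0 sqr_ge0.
  move=> /le_trans; apply; rewrite (le_trans H)// gerBl invr_ge0//.
elim: n => [|n IH]; first by rewrite big_nat1 expr1n invr1; lra.
rewrite big_nat_recr//= (le_trans (lerD IH (lexx _)))//.
have a0 : 0 < n.+1%:R :> R by rewrite ltr0n.
rewrite -[n.+2%:R]natr1; move: (n.+1%:R : R) a0 => a a0.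
rewrite -subr_ge0 (_ : _ - _ = (a * (a + 1) ^+ 2)^-1); first by rewrite invr_ge0 mulr_ge0 ?sqr_ge0 ?ltW.
by field; apply/andP; split; rewrite gt_eqF// ?addr_gt0.
Qed.
End Sandwich.

(** * Almost sure convergence from second moment bounds *)

Section StrongLaw.
Context {d : measure_display} {T : measurableType d} {R : realType}.
Variable P : probability T R.

(** By monotone convergence the series of the [g m] has finite mean, so it converges almost surely
    and its terms tend to 0. *)
Lemma ae_cvg0_summable_mean (g : nat -> T -> R) (C : R) :
  (forall m, measurable_fun setT (g m)) -> (forall m w, 0 <= g m w) ->
  (forall n, \sum_(0 <= m < n) \int[P]_w (g m w)%:E <= C%:E)%E ->
  {ae P, forall w, g m w @[m --> \oo] --> (0 : R)}.
Proof.
move=> mg g0 gC.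
have mge m : measurable_fun setT (EFin \o g m) by exact/measurable_EFinP.
have ge0 m w : (0 <= (EFin \o g m) w)%E by rewrite lee_fin.
pose G w := (\sum_(m <oo) (g m w)%:E)%E.
have IG : (\int[P]_w G w <= C%:E)%E.
  rewrite (@integral_nneseries _ _ _ P _ measurableT (fun m => EFin \o g m))//.
  apply: lime_le; last by apply: nearW.
  by apply: is_cvg_nneseries => m _ _; apply: integral_ge0 => w _.
have Gge0 w : (0 <= G w)%E by apply: nneseries_ge0 => m _ _; exact: ge0.
have Gi : P.-integrable setT G.
  apply/integrableP; split.
    apply: ge0_emeasurable_sum => [k w _ _|k _]; [exact: ge0|exact: mge].
  under eq_integral do rewrite gee0_abs//.
  by rewrite (le_lt_trans IG)// ltry.
apply: filterS (integrable_ae measurableT Gi) => w /(_ I) Gw.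
apply: (@cvg_series_cvg_0 R R^o); apply: nondecreasing_is_cvgn.
  by apply: nondecreasing_series.
exists (fine (G w)) => _ [n _ <-].
rewrite -lee_fin fineK// /series/= -sumEFin.
by apply: (@nneseries_lim_ge _ (fun m => (g m w)%:E)) => m _ _; exact: ge0.
Qed.

Lemma slln_nonneg (Z : nat -> T -> R) (c C a : R) :
  (forall k, measurable_fun setT (Z k)) -> (forall k w, 0 <= Z k w) ->
  0 <= C -> a < 2 ->
  (forall n, \int[P]_w ((\sum_(k < n) Z k w - n%:R * c) ^+ 2)%:E <=
    (C * n%:R `^ a)%:E)%E ->
  {ae P, forall w, n%:R^-1 * \sum_(0 <= k < n) Z k w @[n --> \oo] --> c}.
Proof.
move=> mZ Z0 C0 a2 varZ.
(* This [p] satisfies [p (2 - a) >= 2]. Hence at [n = (m+1)^p] the second moment of the centred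
   average, at most [C n^(a-2)], is at most [C / (m+1)^2]. *)
pose p := (Num.trunc (2 / (2 - a))).+1.
have p2 : 2 <= p%:R * (2 - a).
  by rewrite -ler_pdivrMr ?subr_gt0// ltW// truncnS_gt.
pose S n w := \sum_(0 <= k < n) Z k w.
have mS n : measurable_fun setT (S n) by exact: measurable_sum.
(* The shift to [m.+1] keeps the denominators positive. *)
pose g m w := (S (m.+1 ^ p)%N w / (m.+1 ^ p)%:R - c) ^+ 2.
have mg m : measurable_fun setT (g m).
  apply: measurable_funX; apply: measurable_funB => //.
  exact: measurable_funM.
have g_le m : (\int[P]_w (g m w)%:E <= (C * (m.+1%:R ^+ 2)^-1)%:E)%E.
  have n0 : 0 < (m.+1 ^ p)%:R :> R by rewrite ltr0n expn_gt0.
  rewrite (_ : (fun w => (g m w)%:E) = fun w => (((m.+1 ^ p)%:R ^+ 2)^-1)%:E *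
     ((\sum_(k < (m.+1 ^ p)%N) Z k w - (m.+1 ^ p)%:R * c) ^+ 2)%:E)%E; last first.
    apply/funext => w; rewrite -EFinM /g /S big_mkord; congr EFin.
    by field; rewrite gt_eqF.
  rewrite ge0_integralZl//; last 2 first.
  - apply/measurable_EFinP; apply: measurable_funX; apply: measurable_funB => //.
    exact: measurable_sum.
  - by move=> w _; rewrite lee_fin sqr_ge0.
  apply: (le_trans (lee_wpmul2l _ (varZ _))); first by rewrite lee_fin invr_ge0 sqr_ge0.
  rewrite -EFinM lee_fin mulrCA ler_wpM2l//.
  rewrite ler_pdivrMl ?exprn_gt0// ler_pdivlMr ?exprn_gt0//.
  rewrite natrX -!powR_mulrn// -!powRrM -!powRD; try by apply/implyP; rewrite pnatr_eq0.
  rewrite ler_powR ?ler1n//; lra.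
have ae_g : {ae P, forall w, g m w @[m --> \oo] --> (0 : R)}.
  apply: (@ae_cvg0_summable_mean g (C * 2)) => //.
    by move=> m w; exact: sqr_ge0.
  move=> n; apply: (@le_trans _ _ (\sum_(0 <= m < n) (C * (m.+1%:R ^+ 2)^-1)%:E)%E).
    by apply: lee_sum => m _; exact: g_le.
  by rewrite sumEFin lee_fin -mulr_sumr ler_wpM2l// sum_inv_sqr_le2.
apply: filterS ae_g => w gw.
have -> : (fun n => n%:R^-1 * \sum_(0 <= k < n) Z k w) = (fun n => S n w / n%:R).
  by apply/funext => n; rewrite mulrC.
apply: (@cvg_mean_subseq R (S ^~ w) c p) => //.
- by move=> m n mn; rewrite /S [leRHS](big_cat_nat (leq0n m) mn)//= lerDl sumr_ge0.
- by rewrite /S big_nil.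
- rewrite -(cvg_shiftS (fun m => S (m ^ p)%N w / (m ^ p)%:R)).
  apply/cvgrPdist_lt => e e0.
  have e2 : 0 < e ^+ 2 by rewrite exprn_gt0.
  move/cvgrPdist_lt : gw => /(_ _ e2); apply: filterS => m.
  rewrite sub0r normrN ger0_norm ?sqr_ge0// distrC => ge.
  rewrite /= -(@ltr_pXn2r _ 2) ?nnegrE ?normr_ge0 ?(ltW e0)//.
  by rewrite (real_normK (num_real _)).
Qed.

End StrongLaw.

(** * Strong law for squares *)

Section QuadraticLaw.
Context {d : measure_display} {T : measurableType d} {R : realType}.
Variable P : probability T R.
Implicit Types (f g : T -> R).

Local Notation E f := (Rintegral P setT f).
Local Notation itg f := (P.-integrable setT (EFin \o f)).

Lemma mean_sqr_sum n (Y : nat -> T -> R) :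
  (forall k l, itg (fun w => Y k w * Y l w)) ->
  itg (fun w => (\sum_(k < n) Y k w) ^+ 2) /\
  \int[P]_w ((\sum_(k < n) Y k w) ^+ 2) =
    \sum_(k < n) \sum_(l < n) \int[P]_w (Y k w * Y l w).
Proof.
move=> iY.
have -> : (fun w => (\sum_(k < n) Y k w) ^+ 2) =
    (fun w => \sum_(k < n) \sum_(l < n) Y k w * Y l w).
  by apply/funext => w; rewrite expr2 big_distrlr.
have iY2 k := mean_sum n (iY k).
have [i e] := @mean_sum _ _ _ P n (fun k w => \sum_(l < n) Y k w * Y l w)
  (fun k => (iY2 k).1).
split=> //; rewrite e; apply: eq_bigr => k _; exact: (iY2 k).2.
Qed.

Lemma le_mean f g : itg f -> itg g -> (forall w, f w <= g w) -> E f <= E g.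
Proof. by move=> fi gi fg; apply: le_Rintegral. Qed.

Lemma integral_mean f : itg f -> (\int[P]_w (f w)%:E = (E f)%:E)%E.
Proof. by move=> fi; rewrite /Rintegral fineK//; exact: integrable_fin_num. Qed.

Variables (X : nat -> T -> R) (c K C a : R).
Hypotheses (LX : forall k, L4 P (X k)) (EX2 : forall k, E (fun w => X k w ^+ 2) = c).
Hypothesis covX : forall k l, E (fun w => X k w ^+ 2 * X l w ^+ 2) - c ^+ 2 <=
  K * E (fun w => X k w * X l w).
Hypotheses (K0 : 0 <= K) (C0 : 0 <= C) (a2 : a < 2).
Hypothesis varX : forall n,
  \int[P]_w ((\sum_(k < n) X k w) ^+ 2) <= C * n%:R `^ a.

Let iX2 k : itg (fun w => X k w ^+ 2).
Proof. by have := L4_prod2 (LX k) (LX k); under eq_fun do rewrite -expr2. Qed.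

Let iX22 k l : itg (fun w => X k w ^+ 2 * X l w ^+ 2).
Proof.
have := L4_prod4 (LX k) (LX k) (LX l) (LX l).
by under eq_fun do rewrite -mulrA -!expr2.
Qed.

Let iXX k l : itg (fun w => X k w * X l w).
Proof. exact: L4_prod2. Qed.

Let s2 k l := [:: (1, fun w => X k w ^+ 2 * X l w ^+ 2); (- c, fun w => X k w ^+ 2);
  (- c, fun w => X l w ^+ 2); (c ^+ 2, cst (1 : R))] : seq (R * (T -> R)).

Let Y k w := X k w ^+ 2 - c.

Let YE k l : (fun w => Y k w * Y l w) = lincomb (s2 k l).
Proof. by apply/funext => w; rewrite /Y /=; ring. Qed.

Let s2i k l : lincomb_integrable P (s2 k l).
Proof. by do !split => //; apply: L4_itg; exact: L4_cst. Qed.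

(** Summing [covX] over all pairs bounds the second moment of the sum of the centred squares by [K]
    times that of the sum of the [X k], whose growth is given by [varX]. *)
Let var_sqr n : itg (fun w => (\sum_(k < n) Y k w) ^+ 2) /\
  \int[P]_w ((\sum_(k < n) Y k w) ^+ 2) <= K * C * n%:R `^ a.
Proof.
have iY k l : itg (fun w => Y k w * Y l w) by rewrite YE; exact: integrable_lincomb.
have [i ->] := mean_sqr_sum n iY; split => //.
have [_ eX] := mean_sqr_sum n iXX.
rewrite -mulrA; apply: le_trans (ler_wpM2l K0 (varX n)).
rewrite eX mulr_sumr; apply: ler_sum => k _; rewrite mulr_sumr; apply: ler_sum => l _.
rewrite YE mean_lincomb; last exact: s2i.
rewrite /= !EX2 (mean_cst P 1); apply: le_trans (covX k l).
by rewrite le_eqVlt; apply/orP; left; apply/eqP; ring.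
Qed.

Lemma quadratic_slln :
  {ae P, forall w, n%:R^-1 * \sum_(0 <= k < n) X k w ^+ 2 @[n --> \oo] --> c}.
Proof.
apply: (@slln_nonneg _ _ _ P (fun k w => X k w ^+ 2) c (K * C) a) => //.
- by move=> k; apply: measurable_funX; exact: (LX k).1.
- by move=> k w; exact: sqr_ge0.
- exact: mulr_ge0.
move=> n; have [i e] := var_sqr n.
rewrite (_ : (fun w => _) = (fun w => ((\sum_(k < n) Y k w) ^+ 2)%:E)); last first.
  apply/funext => w; rewrite /Y sumrB sumr_const card_ord.
  by rewrite mulr_natl.
by rewrite integral_mean// lee_fin.
Qed.

(* [(x + 1)^2] is non-negative, unlike [x], and [2 x = (x + 1)^2 - x^2 - 1]. *)
Lemma linear_slln :
  {ae P, forall w, n%:R^-1 * \sum_(0 <= k < n) X k w @[n --> \oo] --> (0 : R)}.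
Proof.
have H : {ae P, forall w, n%:R^-1 * \sum_(0 <= k < n) (X k w + 1) ^+ 2 @[n --> \oo] --> c + 1}.
  (* The centred sum of the [(X k + 1)^2] is [x + 2 y], where [x] is the sum of the [Y k] and [y]
     that of the [X k]. The constant comes from [(x + 2 y)^2 <= 2 x^2 + 8 y^2]. *)
  apply: (@slln_nonneg _ _ _ P (fun k w => (X k w + 1) ^+ 2) (c + 1)
    (2 * (K * C) + 8 * C) a) => //.
  - move=> k; apply: measurable_funX; apply: measurable_funD => //; exact: (LX k).1.
  - by move=> k w; exact: sqr_ge0.
  - by rewrite addr_ge0// !mulr_ge0.
  move=> n; have [i e] := var_sqr n; have [iX eX] := mean_sqr_sum n iXX.
  pose Q w := (2 * (\sum_(k < n) Y k w) + 4 * (\sum_(k < n) X k w)).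
  have sE w : \sum_(k < n) (X k w + 1) ^+ 2 - n%:R * (c + 1) =
      \sum_(k < n) Y k w + 2 * \sum_(k < n) X k w.
    rewrite mulr_sumr -big_split/= -[n in n%:R]card_ord mulr_natl -sumr_const -sumrB.
    by apply: eq_bigr => k _; rewrite /Y; ring.
  pose s := [:: (2, fun w => (\sum_(k < n) Y k w) ^+ 2);
    (8, fun w => (\sum_(k < n) X k w) ^+ 2)] : seq (R * (T -> R)).
  have si : lincomb_integrable P s by do !split.
  apply: (@le_trans _ _ (\int[P]_w (lincomb s w)%:E)%E).
    apply: ge0_le_integral => //.
    - by move=> w _; rewrite lee_fin sqr_ge0.
    - apply/measurable_EFinP; apply: measurable_funX; apply: measurable_funB => //.
      apply: measurable_sum => k; apply: measurable_funX; apply: measurable_funD => //.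
      exact: (LX k).1.
    - exact: measurable_int (integrable_lincomb si).
    move=> w _; rewrite lee_fin sE /=.
    move: (\sum_(k < n) Y k w) (\sum_(k < n) X k w) => x y.
    by have := sqr_ge0 (x - 2 * y); nra.
  rewrite integral_mean; last exact: integrable_lincomb.
  by rewrite lee_fin (mean_lincomb si)/= addr0; have := varX n; lra.
apply: filterS2 H quadratic_slln => w H1 H2.
have lim0 : 2^-1 * (c + 1 - c - 1) = 0 :> R by ring.
have L : 2^-1 * (n%:R^-1 * \sum_(0 <= k < n) (X k w + 1) ^+ 2 -
    n%:R^-1 * \sum_(0 <= k < n) X k w ^+ 2 - 1) @[n --> \oo] --> 2^-1 * (c + 1 - c - 1).
  exact: cvgM (cvg_cst _) (cvgB (cvgB H1 H2) (cvg_cst _)).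
rewrite lim0 in L; apply: cvg_trans L.
apply: near_eq_cvg.
near=> n.
have n0 : n%:R != 0 :> R by rewrite pnatr_eq0 -lt0n; near: n; exact: nbhs_infty_gt.
rewrite /=.
have -> : \sum_(0 <= k < n) (X k w + 1) ^+ 2 =
    \sum_(0 <= k < n) X k w ^+ 2 + 2 * (\sum_(0 <= k < n) X k w) + n%:R.
  have -> : n%:R = \sum_(0 <= k < n) 1 :> R by rewrite sumr_const_nat subn0.
  rewrite mulr_sumr -!big_split/=.
  by apply: eq_bigr => k _; ring.
by field.
Unshelve. all: by end_near. Qed.

End QuadraticLaw.

(** * Fourth-order products *)

Section GaussianProducts.
Context {d : measure_display} {T : measurableType d} {R : realType}.
Variable P : probability T R.
Implicit Types (X Y f g : T -> R).

Local Notation E f := (Rintegral P setT f).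
Local Notation itg f := (P.-integrable setT (EFin \o f)).

Lemma mean_lincombE f s : f =1 lincomb s -> lincomb_integrable P s ->
  E f = lincomb_mean P s.
Proof. by move=> /funext -> /mean_lincomb. Qed.

Lemma L4_sqr X : L4 P X -> itg (fun w => X w ^+ 2).
Proof. by move=> hX; have := L4_prod2 hX hX; under eq_fun do rewrite -expr2. Qed.

Lemma L4_sqr_sqr X Y : L4 P X -> L4 P Y -> itg (fun w => X w ^+ 2 * Y w ^+ 2).
Proof.
move=> hX hY; have := L4_prod4 hX hX hY hY.
by under eq_fun do rewrite -mulrA -!expr2.
Qed.

Lemma mean_sqrD a b X Y : L4 P X -> L4 P Y ->
  E (fun w => (a * X w + b * Y w) ^+ 2) =
  a ^+ 2 * E (fun w => X w ^+ 2) + 2 * a * b * E (fun w => X w * Y w)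
  + b ^+ 2 * E (fun w => Y w ^+ 2).
Proof.
move=> hX hY.
rewrite (@mean_lincombE _ [:: (a ^+ 2, fun w => X w ^+ 2);
  (2 * a * b, fun w => X w * Y w); (b ^+ 2, fun w => Y w ^+ 2)]) /=.
- by rewrite addr0 addrA.
- by move=> w /=; ring.
- by split; [exact: L4_sqr|split; [exact: L4_prod2|split; [exact: L4_sqr|]]].
Qed.

(* [12 x^2 y^2 = (x + y)^4 + (x - y)^4 - 2 x^4 - 2 y^4] *)
Lemma isserlis X Y : L4 P X -> L4 P Y ->
  (forall a b, E (fun w => (a * X w + b * Y w) ^+ 4) =
             3 * E (fun w => (a * X w + b * Y w) ^+ 2) ^+ 2) ->
  E (fun w => X w ^+ 2 * Y w ^+ 2) =
  E (fun w => X w ^+ 2) * E (fun w => Y w ^+ 2) + 2 * E (fun w => X w * Y w) ^+ 2.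
Proof.
move=> hX hY H4.
have Lc a b : L4 P (fun w => a * X w + b * Y w) by apply: L4D; exact: L4Z.
rewrite (@mean_lincombE _ [:: (12^-1, fun w => (1 * X w + 1 * Y w) ^+ 4);
  (12^-1, fun w => (1 * X w + (-1) * Y w) ^+ 4);
  (- 6^-1, fun w => (1 * X w + 0 * Y w) ^+ 4);
  (- 6^-1, fun w => (0 * X w + 1 * Y w) ^+ 4)]); first last.
- by do !split => //; exact: (Lc _ _).2.
- by move=> w /=; field.
rewrite /= !H4 !mean_sqrD//.
by field.
Qed.

Variables (GU GV : set_system T).
Hypothesis GUV : independent P <<s GU>> <<s GV>>.

Local Notation measU f := (measurable_fun (T := g_sigma_algebraType GU) setT f).
Local Notation measV f := (measurable_fun (T := g_sigma_algebraType GV) setT f).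

Variables (U1 U2 V1 V2 : T -> R).
Hypotheses (LU1 : L4 P U1) (LU2 : L4 P U2) (LV1 : L4 P V1) (LV2 : L4 P V2).
Hypotheses (mU1 : measU U1) (mU2 : measU U2) (mV1 : measV V1) (mV2 : measV V2).
Hypotheses (EU1 : E U1 = 0) (EU2 : E U2 = 0) (EV1 : E V1 = 0) (EV2 : E V2 = 0).

Lemma mean_cross : E (fun w => U1 w * V1 w) = 0.
Proof.
rewrite (mean_independent GUV mU1 mV1) ?EU1 ?mul0r//.
- exact: LU1.1.
- exact: LV1.1.
- exact: L4_itg.
- exact: L4_itg.
- exact: L4_prod2.
Qed.

(** Isserlis' identity for the mixed pair, whose covariance is [gamma^2 r]. It follows by expanding
    the product: independence and centring remove the terms of odd degree in the [U] variables, and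
    the term in [U1 U2 V1 V2] vanishes because [U1] and [U2] are uncorrelated. *)
Lemma mean_mixed_sqr_sqr (sigma gamma u v r : R) :
  E (fun w => U1 w ^+ 2) = u -> E (fun w => U2 w ^+ 2) = u ->
  E (fun w => V1 w ^+ 2) = v -> E (fun w => V2 w ^+ 2) = v ->
  E (fun w => U1 w * U2 w) = 0 -> E (fun w => U1 w ^+ 2 * U2 w ^+ 2) = u ^+ 2 ->
  E (fun w => V1 w * V2 w) = r ->
  E (fun w => V1 w ^+ 2 * V2 w ^+ 2) = v ^+ 2 + 2 * r ^+ 2 ->
  E (fun w => (sigma * U1 w + gamma * V1 w) ^+ 2 *
              (sigma * U2 w + gamma * V2 w) ^+ 2) =
  (sigma ^+ 2 * u + gamma ^+ 2 * v) ^+ 2 + 2 * (gamma ^+ 2 * r) ^+ 2.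
Proof.
move=> u1 u2 v1 v2 u12 u22 v12 v22.
(* Monomials of type 3 + 1 or 1 + 3 vanish because the lone factor is centred; those of type 2 + 2
   split into a product of two means. *)
have ind31 A1 A2 A3 B : L4 P A1 -> L4 P A2 -> L4 P A3 -> L4 P B ->
    measU A1 -> measU A2 -> measU A3 -> measV B -> E B = 0 ->
    E (fun w => A1 w * A2 w * A3 w * B w) = 0.
  move=> L1 L2 L3 LB m1 m2 m3 mB EB.
  rewrite (mean_independent (f := fun w => A1 w * A2 w * A3 w) GUV _ mB).
  - by rewrite EB mulr0.
  - by apply: measurable_funM => //; exact: measurable_funM.
  - by apply: measurable_funM; [apply: measurable_funM; [exact: L1.1|exact: L2.1]|exact: L3.1].
  - exact: LB.1.
  - exact: L4_prod3.
  - exact: L4_itg.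
  - exact: L4_prod4.
have ind13 A B1 B2 B3 : L4 P A -> L4 P B1 -> L4 P B2 -> L4 P B3 ->
    measU A -> measV B1 -> measV B2 -> measV B3 -> E A = 0 ->
    E (fun w => A w * (B1 w * B2 w * B3 w)) = 0.
  move=> LA L1 L2 L3 mA m1 m2 m3 EA.
  rewrite (mean_independent (g := fun w => B1 w * B2 w * B3 w) GUV mA).
  - by rewrite EA mul0r.
  - by apply: measurable_funM => //; exact: measurable_funM.
  - exact: LA.1.
  - by apply: measurable_funM; [apply: measurable_funM; [exact: L1.1|exact: L2.1]|exact: L3.1].
  - exact: L4_itg.
  - exact: L4_prod3.
  - by under eq_fun do rewrite !mulrA; exact: L4_prod4.
have ind22 A1 A2 B1 B2 : L4 P A1 -> L4 P A2 -> L4 P B1 -> L4 P B2 ->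
    measU A1 -> measU A2 -> measV B1 -> measV B2 ->
    E (fun w => A1 w * A2 w * (B1 w * B2 w)) =
    E (fun w => A1 w * A2 w) * E (fun w => B1 w * B2 w).
  move=> LA1 LA2 LB1 LB2 mA1 mA2 mB1 mB2.
  rewrite (mean_independent (f := fun w => A1 w * A2 w) (g := fun w => B1 w * B2 w) GUV) //.
  - exact: measurable_funM.
  - exact: measurable_funM.
  - by apply: measurable_funM; [exact: LA1.1|exact: LA2.1].
  - by apply: measurable_funM; [exact: LB1.1|exact: LB2.1].
  - exact: L4_prod2.
  - exact: L4_prod2.
  - by under eq_fun do rewrite mulrA; exact: L4_prod4.
rewrite (@mean_lincombE _ [::
  (sigma ^+ 4, fun w => U1 w ^+ 2 * U2 w ^+ 2);
  (2 * sigma ^+ 3 * gamma, fun w => U1 w * U1 w * U2 w * V2 w);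
  (2 * sigma ^+ 3 * gamma, fun w => U1 w * U2 w * U2 w * V1 w);
  (sigma ^+ 2 * gamma ^+ 2, fun w => U1 w * U1 w * (V2 w * V2 w));
  (4 * sigma ^+ 2 * gamma ^+ 2, fun w => U1 w * U2 w * (V1 w * V2 w));
  (sigma ^+ 2 * gamma ^+ 2, fun w => U2 w * U2 w * (V1 w * V1 w));
  (2 * sigma * gamma ^+ 3, fun w => U1 w * (V1 w * V2 w * V2 w));
  (2 * sigma * gamma ^+ 3, fun w => U2 w * (V1 w * V1 w * V2 w));
  (gamma ^+ 4, fun w => V1 w ^+ 2 * V2 w ^+ 2)]); first last.
- have i22 A B C D : L4 P A -> L4 P B -> L4 P C -> L4 P D ->
      itg (fun w => A w * B w * (C w * D w)).
    by move=> *; under eq_fun do rewrite mulrA; exact: L4_prod4.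
  have i13 A B C D : L4 P A -> L4 P B -> L4 P C -> L4 P D ->
      itg (fun w => A w * (B w * C w * D w)).
    by move=> *; under eq_fun do rewrite !mulrA; exact: L4_prod4.
  do !split; [exact: L4_sqr_sqr|exact: L4_prod4|exact: L4_prod4|exact: i22|exact: i22
    |exact: i22|exact: i13|exact: i13|exact: L4_sqr_sqr].
- by move=> w /=; ring.
rewrite /= u22 v22 !ind31// !ind13// !ind22// u12 v12.
have sq A : E (fun w => A w * A w) = E (fun w => A w ^+ 2).
  by apply: eq_Rintegral => w _; rewrite expr2.
rewrite !sq u1 u2 v1 v2.
by ring.
Qed.

End GaussianProducts.

(** * Brownian and fractional increments *)

Section Increments.
Context {d : measure_display} {T : measurableType d} {R : realType}.
Variable P : probability T R.
Implicit Types (W V : R -> {RV P >-> R}) (Y : T -> R) (s t : R).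

Local Notation E f := (Rintegral P setT f).
Local Notation itg f := (P.-integrable setT (EFin \o f)).

Lemma gaussian_L4 Y : measurable_fun setT Y -> gaussian P Y -> L4 P Y.
Proof. by move=> mY [m [s [s0 Ylaw]]]; have [] := normal_law_moments mY s0 Ylaw. Qed.

Lemma centered_gaussian_moment4 Y : measurable_fun setT Y -> gaussian P Y ->
  E Y = 0 -> E (fun w => Y w ^+ 4) = 3 * E (fun w => Y w ^+ 2) ^+ 2.
Proof.
move=> mY [m [s [s0 Ylaw]]] EY; have [_ Em mom] := normal_law_moments mY s0 Ylaw.
have [|-> ->] := mom; first by rewrite -Em.
by rewrite -exprM.
Qed.

Definition incr (X : R -> {RV P >-> R}) s t : T -> R := fun w => X t w - X s w.

(** * Brownian increments: moments and independence *)

Section Brownian.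
Variable W : R -> {RV P >-> R}.
Hypothesis Wbm : standard_brownian_motion W.

Lemma measurable_incr (X : R -> {RV P >-> R}) s t : measurable_fun setT (incr X s t).
Proof. exact: measurable_funB. Qed.

Lemma brownian_incr_moments s t : 0 <= s -> s <= t ->
  [/\ L4 P (incr W s t), E (incr W s t) = 0,
     E (fun w => incr W s t w ^+ 2) = t - s &
     E (fun w => incr W s t w ^+ 4) = 3 * (t - s) ^+ 2].
Proof.
move=> s0 st; case: Wbm => _ _ law _.
have ts0 : 0 <= t - s by rewrite subr_ge0.
have [L4W EW mom] := normal_law_moments (measurable_incr W s t) (sqrtr_ge0 _) (law s t s0 st).
have [E2 E4] := mom erefl.
split=> //; first by rewrite E2 sqr_sqrtr.
by rewrite E4 -[4%N]/(2 * 2)%N exprM sqr_sqrtr.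
Qed.

Lemma brownian_incr_independent a b c e (A1 A2 : set R) :
  0 <= a -> a <= b -> b <= c -> c <= e -> measurable A1 -> measurable A2 ->
  P (incr W a b @^-1` A1 `&` incr W c e @^-1` A2) =
  (P (incr W a b @^-1` A1) * P (incr W c e @^-1` A2))%E.
Proof.
move=> a0 ab bc ce mA1 mA2; case: Wbm => _ ind _ _.
(* The times are [a, b, c, e, e, ...]: the default value of [nth] supplies the fourth time and keeps
   the sequence monotone. Increments 0 and 2 are the two of interest. *)
pose t (k : nat) := nth e [:: a; b; c] k.
have tmon : {homo t : i j / (i <= j)%N >-> i <= j}.
  apply: homo_leq => [x|x y z|k]; first exact: lexx.
    exact: le_trans.
  by rewrite /t; do 4 (case: k => [|k] //=); rewrite ?nth_nil.
pose i0 : 'I_3 := ord0; pose i2 : 'I_3 := ord_max.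
pose A (k : 'I_3) := if k == i0 then incr W a b @^-1` A1 else incr W c e @^-1` A2.
have := ind 3%N t a0 tmon [:: i0; i2] A isT.
rewrite !big_cons big_nil mule1 => <-.
  congr (P _); rewrite eqEsubset; split => [w [w1 w2] k /=|w wA].
    by rewrite !inE => /orP[] /eqP ->.
  by split; [apply: (wA i0)|apply: (wA i2)]; rewrite /= !inE eqxx ?orbT.
move=> j; rewrite !inE => /orP[] /eqP ->; apply: sub_sigma_algebra.
  by exists i0 => //; exists A1 => //; rewrite setTI.
by exists i2 => //; exists A2 => //; rewrite setTI.
Qed.

Lemma brownian_disjoint_moments a b c e : 0 <= a -> a <= b -> b <= c -> c <= e ->
  E (fun w => incr W a b w * incr W c e w) = 0 /\
  E (fun w => incr W a b w ^+ 2 * incr W c e w ^+ 2) = (b - a) * (e - c).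
Proof.
move=> a0 ab bc ce.
have c0 : 0 <= c by rewrite (le_trans _ bc)// (le_trans _ ab).
have [LX EX EX2 _] := brownian_incr_moments a0 ab.
have [LY EY EY2 _] := brownian_incr_moments c0 ce.
have ind := fun A1 A2 => brownian_incr_independent (A1 := A1) (A2 := A2) a0 ab bc ce.
split.
  rewrite (integral_independent LX.1 LY.1 ind) ?EX ?mul0r//; first exact: L4_itg.
    exact: L4_itg.
  exact: L4_prod2.
rewrite (integral_independent (f := fun w => incr W a b w ^+ 2)
  (g := fun w => incr W c e w ^+ 2)) ?EX2 ?EY2//.
- by apply: measurable_funX; exact: LX.1.
- by apply: measurable_funX; exact: LY.1.
- move=> A1 A2 mA1 mA2.
  have msq (A : set R) : measurable A -> measurable ((fun x : R => x ^+ 2) @^-1` A).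
    by move=> mA; rewrite -[X in measurable X]setTI; exact: measurable_funX.
  exact: (ind _ _ (msq _ mA1) (msq _ mA2)).
- exact: L4_sqr.
- exact: L4_sqr.
- exact: L4_sqr_sqr.
Qed.

End Brownian.

(** * Fractional increments: Gaussian combinations and fourth moments *)

Section Fractional.
Variables (H : R) (V : R -> {RV P >-> R}).
Hypotheses (H0 : 0 < H) (Vfbm : fractional_brownian_motion H V).

Lemma fbm_combination_gaussian (n : nat) (t a : 'I_n -> R) : (forall k, 0 <= t k) ->
  gaussian P (fun w => \sum_(k < n) a k * V (t k) w).
Proof. by case: Vfbm => G _ _; exact: G. Qed.

Lemma fbm_L4 t : 0 <= t -> L4 P (V t).
Proof.
move=> t0; apply: gaussian_L4; first exact: measurable_funP.
have := @fbm_combination_gaussian 1 (fun=> t) (fun=> 1) (fun=> t0).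
by under eq_fun do rewrite big_ord1 mul1r.
Qed.

Lemma fbm_mean t : 0 <= t -> E (V t) = 0.
Proof.
move=> t0; case: Vfbm => _ EV _; have := EV t t0.
by rewrite unlock /Rintegral => ->.
Qed.

Lemma fbm_cov s t : 0 <= s -> 0 <= t -> E (fun w => V s w * V t w) =
  (t `^ (2 * H) + s `^ (2 * H) - `|t - s| `^ (2 * H)) / 2.
Proof.
move=> s0 t0; case: Vfbm => _ EV CV; have := CV s t s0 t0.
rewrite unlock !EV//= unlock /Rintegral => Cst.
suff -> : (\int[P]_x (V s x * V t x)%:E)%E =
    ((t `^ (2 * H) + s `^ (2 * H) - `|t - s| `^ (2 * H)) / 2)%:E by [].
rewrite -Cst; apply: eq_integral => w _.
by rewrite /cst !fctE /= !subr0.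
Qed.

Lemma fbm_incr_L4 s t : 0 <= s -> 0 <= t -> L4 P (incr V s t).
Proof. by move=> s0 t0; apply: L4B; exact: fbm_L4. Qed.

Lemma fbm_incr_mean s t : 0 <= s -> 0 <= t -> E (incr V s t) = 0.
Proof.
move=> s0 t0; rewrite RintegralB//; last 2 first.
- by apply: L4_itg; exact: fbm_L4.
- by apply: L4_itg; exact: fbm_L4.
by rewrite !fbm_mean// subrr.
Qed.

Lemma fbm_incr_sqr s t : 0 <= s -> 0 <= t ->
  E (fun w => incr V s t w ^+ 2) = `|t - s| `^ (2 * H).
Proof.
move=> s0 t0.
rewrite (@mean_lincombE _ _ _ P _ [:: (1, fun w => V t w * V t w);
  (-2, fun w => V s w * V t w); (1, fun w => V s w * V s w)]) /=.
- by rewrite !fbm_cov// !subrr normr0 powR0 ?mulf_neq0 ?gt_eqF//; field.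
- by move=> w /=; rewrite /incr; ring.
- by do !split; apply: L4_prod2; exact: fbm_L4.
Qed.

(** A combination of two increments is a combination of the values at four times, hence a centred
    Gaussian variable. This provides the hypothesis of [isserlis]. *)
Lemma fbm_incr_combination a b s t s' t' : 0 <= s -> 0 <= t -> 0 <= s' -> 0 <= t' ->
  E (fun w => (a * incr V s t w + b * incr V s' t' w) ^+ 4) =
  3 * E (fun w => (a * incr V s t w + b * incr V s' t' w) ^+ 2) ^+ 2.
Proof.
move=> s0 t0 s'0 t'0.
have L1 := fbm_incr_L4 s0 t0; have L2 := fbm_incr_L4 s'0 t'0.
apply: (@centered_gaussian_moment4 (fun w => a * incr V s t w + b * incr V s' t' w)).
- by apply: measurable_funD; apply: measurable_funM => //; [exact: L1.1|exact: L2.1].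
- have := @fbm_combination_gaussian 4 (fun k => nth 0 [:: s; t; s'; t'] k)
    (fun k => nth 0 [:: - a; a; - b; b] k) _.
  rewrite (_ : (fun w => \sum_(k < 4) _) =
    (fun w => a * incr V s t w + b * incr V s' t' w)); last first.
    by apply/funext => w; rewrite !big_ord_recl big_ord0 /= /incr; ring.
  by apply=> -[k /=]; do 4 (case: k => [|k] //=).
- rewrite (@mean_lincombE _ _ _ P _ [:: (a, incr V s t); (b, incr V s' t')]) /=.
  + by rewrite !fbm_incr_mean// !mulr0 !addr0.
  + by move=> w /=; rewrite addr0.
  + by do !split; exact: L4_itg.
Qed.

Lemma fbm_incr_isserlis s t s' t' : 0 <= s -> 0 <= t -> 0 <= s' -> 0 <= t' ->
  E (fun w => incr V s t w ^+ 2 * incr V s' t' w ^+ 2) =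
  E (fun w => incr V s t w ^+ 2) * E (fun w => incr V s' t' w ^+ 2) +
  2 * E (fun w => incr V s t w * incr V s' t' w) ^+ 2.
Proof.
move=> s0 t0 s'0 t'0; apply: isserlis; [exact: fbm_incr_L4|exact: fbm_incr_L4|].
by move=> a b; exact: fbm_incr_combination.
Qed.

Lemma fbm_incr_moment4 s t : 0 <= s -> 0 <= t ->
  E (fun w => incr V s t w ^+ 4) = 3 * (`|t - s| `^ (2 * H)) ^+ 2.
Proof.
move=> s0 t0; rewrite -fbm_incr_sqr//.
have := fbm_incr_combination 1 0 s0 t0 s0 t0.
by under eq_Rintegral do rewrite mul1r mul0r addr0;
   under [in RHS]eq_Rintegral do rewrite mul1r mul0r addr0.
Qed.

End Fractional.
End Increments.

(** * Mixed increments *)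

Section MixedSecondDifference.
Context {R : realType}.
Variables (p : R).
Hypothesis p1 : 1 <= p.

Lemma powR_midpoint (x y : R) : 0 <= x -> 0 <= y ->
  2 * ((x + y) / 2) `^ p <= x `^ p + y `^ p.
Proof.
move=> x0 y0.
have h0 : 0 <= (2^-1 : R) by lra.
have h1 : (2^-1 : R) <= 1 by lra.
have := @convex_powR R p p1 (Itv01 h0 h1) x y.
rewrite !inE/= !in_itv/= !andbT => /(_ x0 y0).
rewrite convRE [X in X `^ _ <= _]convRE /=.
have -> : unstable.onem 2^-1 = 2^-1 :> R by rewrite /unstable.onem; field.
rewrite (_ : _ + _ = (x + y) / 2); last by field.
lra.
Qed.

End MixedSecondDifference.

Section Mixed.
Context {d : measure_display} {T : measurableType d} {R : realType}.
Variable P : probability T R.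
Local Notation E f := (Rintegral P setT f).
Local Notation itg f := (P.-integrable setT (EFin \o f)).

Variables (sigma gamma H : R) (W V : R -> {RV P >-> R}).
Hypotheses (H0 : 0 < H).
Hypotheses (Wbm : standard_brownian_motion W) (Vfbm : fractional_brownian_motion H V).
Hypothesis WV : independent P (sigma_generated [set t : R | 0 <= t] W)
  (sigma_generated [set t : R | 0 <= t] V).

Definition mincr s t w := sigma * incr W s t w + gamma * incr V s t w.

(** The variance of a mixed increment over a time span [y]; see [mincr_sqr]. *)
Definition mvar (y : R) := sigma ^+ 2 * y + gamma ^+ 2 * y `^ (2 * H).

Lemma mincrN s t w : mincr t s w = - mincr s t w.
Proof. by rewrite /mincr /incr; ring. Qed.

Lemma incr_sigma_measurable (X : R -> {RV P >-> R}) s t : 0 <= s -> 0 <= t ->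
  measurable_fun (T := g_sigma_algebraType
    (\bigcup_(i in [set t : R | 0 <= t]) preimage_set_system setT (X i) measurable))
    setT (incr X s t).
Proof.
by move=> s0 t0; apply: measurable_funB;
  apply: (@sigma_generated_measurable _ T R R [set t : R | 0 <= t] (fun i => X i)).
Qed.

Lemma brownian_incr_L4 s t : 0 <= s -> 0 <= t -> L4 P (incr W s t).
Proof.
move=> s0 t0; have [st|/ltW ts] := leP s t.
  by have [] := brownian_incr_moments Wbm s0 st.
have [+ _ _ _] := brownian_incr_moments Wbm t0 ts.
by move=> /(L4Z (-1)); congr L4; apply/funext => w; rewrite /incr; ring.
Qed.

Lemma mincr_L4 s t : 0 <= s -> 0 <= t -> L4 P (mincr s t).
Proof.
move=> s0 t0; apply: L4D; apply: L4Z; first exact: brownian_incr_L4.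
exact: (fbm_incr_L4 Vfbm).
Qed.

Lemma mincr_sqr s t : 0 <= s -> 0 <= t ->
  E (fun w => mincr s t w ^+ 2) = mvar `|t - s|.
Proof.
wlog st : s t / s <= t => [hw s0 t0|s0 t0].
  have [st|/ltW ts] := leP s t; first exact: hw.
  rewrite distrC -hw//; apply: eq_Rintegral => w _.
  by rewrite mincrN sqrrN.
have [LW EW EW2 _] := brownian_incr_moments Wbm s0 st.
have LV := fbm_incr_L4 Vfbm s0 t0.
rewrite mean_sqrD// (mean_cross WV LW LV).
- by rewrite EW2 (fbm_incr_sqr H0 Vfbm)// mulr0 addr0 ger0_norm// subr_ge0.
- exact: incr_sigma_measurable.
- exact: incr_sigma_measurable.
- exact: EW.
Qed.

(** Polarization over four times: twice the product of the increments over [[a, b]] and [[c, e]] is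
    a signed sum of four squared increments, so covariances follow from [mincr_sqr] alone. *)
Lemma mincr_mul a b c e : 0 <= a -> 0 <= b -> 0 <= c -> 0 <= e ->
  E (fun w => mincr a b w * mincr c e w) =
  (mvar `|e - a| + mvar `|c - b| - mvar `|c - a| - mvar `|e - b|) / 2.
Proof.
move=> a0 b0 c0 e0.
rewrite (@mean_lincombE _ _ _ P _ [:: (2^-1, fun w => mincr a e w ^+ 2);
  (2^-1, fun w => mincr b c w ^+ 2); (- 2^-1, fun w => mincr a c w ^+ 2);
  (- 2^-1, fun w => mincr b e w ^+ 2)]) /=.
- by rewrite !mincr_sqr//; field.
- by move=> w /=; rewrite /mincr /incr; field.
- by do !split; apply: L4_sqr; exact: mincr_L4.
Qed.

(** The constant is [8 * 3]: the 8 from [(x + y)^4 <= 8 x^4 + 8 y^4], the 3 from the Gaussian fourth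
    moment. *)
Lemma mincr_moment4_le s t : 0 <= s -> s <= t ->
  E (fun w => mincr s t w ^+ 4) <=
  24 * (sigma ^+ 4 * (t - s) ^+ 2 + gamma ^+ 4 * ((t - s) `^ (2 * H)) ^+ 2).
Proof.
move=> s0 st; have t0 : 0 <= t by rewrite (le_trans s0).
have [LW EW _ EW4] := brownian_incr_moments Wbm s0 st.
have LV := fbm_incr_L4 Vfbm s0 t0.
pose l := [:: (8 * sigma ^+ 4, fun w => incr W s t w ^+ 4);
  (8 * gamma ^+ 4, fun w => incr V s t w ^+ 4)].
have li : lincomb_integrable P l by do !split; [exact: LW.2|exact: LV.2].
apply: (@le_trans _ _ (E (lincomb l))).
  apply: le_mean; first by have [] := mincr_L4 s0 t0.
    exact: integrable_lincomb.
  have pow4D (x y : R) : (x + y) ^+ 4 <= 8 * x ^+ 4 + 8 * y ^+ 4.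
    have := sqr_ge0 (x - y); have := sqr_ge0 (x ^+ 2 - y ^+ 2).
    by have := sqr_ge0 (x + y); nra.
  move=> w; rewrite /l /mincr /= addr0; apply: le_trans (pow4D _ _) _.
  by rewrite !exprMn !mulrA.
rewrite (mean_lincomb li)/= EW4 (fbm_incr_moment4 H0 Vfbm)// ger0_norm ?subr_ge0//.
by rewrite le_eqVlt; apply/orP; left; apply/eqP; ring.
Qed.

(** Brownian increments over disjoint intervals are uncorrelated, so the covariance is [gamma^2]
    times that of the fractional increments, to which [fbm_incr_isserlis] applies. Equal lengths
    give both increments the same variance, as [mean_mixed_sqr_sqr] requires. *)
Lemma mincr_disjoint a b c e : 0 <= a -> a <= b -> b <= c -> c <= e ->
  b - a = e - c ->
  E (fun w => mincr a b w ^+ 2 * mincr c e w ^+ 2) =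
  mvar (b - a) ^+ 2 + 2 * E (fun w => mincr a b w * mincr c e w) ^+ 2.
Proof.
move=> a0 ab bc ce len.
have b0 : 0 <= b by rewrite (le_trans a0).
have c0 : 0 <= c by rewrite (le_trans b0).
have e0 : 0 <= e by rewrite (le_trans c0).
have [LW1 EW1 EW12 _] := brownian_incr_moments Wbm a0 ab.
have [LW2 EW2 EW22 _] := brownian_incr_moments Wbm c0 ce.
have [W12 W1122] := brownian_disjoint_moments Wbm a0 ab bc ce.
have LV1 := fbm_incr_L4 Vfbm a0 b0; have LV2 := fbm_incr_L4 Vfbm c0 e0.
have EV1 := fbm_incr_mean Vfbm a0 b0; have EV2 := fbm_incr_mean Vfbm c0 e0.
have EV12 := fbm_incr_sqr H0 Vfbm a0 b0; have EV22 := fbm_incr_sqr H0 Vfbm c0 e0.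
have mW1 := incr_sigma_measurable (X := W) a0 b0; have mW2 := incr_sigma_measurable (X := W) c0 e0.
have mV1 := incr_sigma_measurable (X := V) a0 b0; have mV2 := incr_sigma_measurable (X := V) c0 e0.
rewrite -len in EW22 W1122 EV22.
pose r := E (fun w => incr V a b w * incr V c e w).
have rho : E (fun w => mincr a b w * mincr c e w) = gamma ^+ 2 * r.
  rewrite (@mean_lincombE _ _ _ P _ [:: (sigma ^+ 2, fun w => incr W a b w * incr W c e w);
    (sigma * gamma, fun w => incr W a b w * incr V c e w);
    (sigma * gamma, fun w => incr W c e w * incr V a b w);
    (gamma ^+ 2, fun w => incr V a b w * incr V c e w)]) /=.
  - rewrite W12 (mean_cross WV LW1 LV2)// (mean_cross WV LW2 LV1)//.
    by rewrite -/r; ring.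
  - by move=> w /=; rewrite /mincr; ring.
  - by do !split; exact: L4_prod2.
have ba : 0 <= b - a by rewrite subr_ge0.
rewrite rho.
apply: (@mean_mixed_sqr_sqr _ _ _ P _ _ WV _ _ _ _ LW1 LW2 LV1 LV2 mW1 mW2 mV1 mV2
   EW1 EW2 EV1 EV2 sigma gamma (b - a) ((b - a) `^ (2 * H)) r) => //.
- by rewrite EV12 ger0_norm.
- by rewrite EV22 ger0_norm.
- by rewrite (fbm_incr_isserlis Vfbm)// EV12 EV22 ger0_norm// -expr2.
Qed.

End Mixed.

(** * Increments on the grid *)

Section Grid.
Context {d : measure_display} {T : measurableType d} {R : realType}.
Variable P : probability T R.
Local Notation E f := (Rintegral P setT f).

Lemma mean_mul_le (Y Z : T -> R) : L4 P Y -> L4 P Z ->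
  E (fun w => Y w * Z w) <= (E (fun w => Y w ^+ 2) + E (fun w => Z w ^+ 2)) / 2.
Proof.
move=> LY LZ.
pose l := [:: (2^-1 : R, fun w => Y w ^+ 2); (2^-1 : R, fun w => Z w ^+ 2)].
have li : lincomb_integrable P l by do !split; exact: L4_sqr.
apply: (@le_trans _ _ (E (lincomb l))).
  apply: le_mean; [exact: L4_prod2|exact: integrable_lincomb|].
  by move=> w; rewrite /=; have := sqr_ge0 (Y w - Z w); nra.
by rewrite (mean_lincomb li)/=; lra.
Qed.

Variables (sigma gamma H h : R) (W V : R -> {RV P >-> R}).
Hypotheses (sigma0 : 0 < sigma) (H12 : 1 / 2 < H) (H1 : H < 1) (h0 : 0 < h).
Hypotheses (Wbm : standard_brownian_motion W) (Vfbm : fractional_brownian_motion H V).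
Hypothesis WV : independent P (sigma_generated [set t : R | 0 <= t] W)
  (sigma_generated [set t : R | 0 <= t] V).
Variable L : nat.
Hypothesis L0 : (0 < L)%N.

Local Notation v := (mvar sigma gamma H).
Local Notation M := (mincr sigma gamma W V).
Let X k : T -> R := M (k%:R * h) ((k + L)%:R * h).
Let A := L%:R * h.

Let H0 : 0 < H. Proof. by move: H12; lra. Qed.
Let p1 : 1 <= 2 * H. Proof. by move: H12; lra. Qed.

Let A0 : 0 < A. Proof. by rewrite mulr_gt0// ltr0n. Qed.

Let grid0 k : 0 <= k%:R * h :> R. Proof. by rewrite mulr_ge0// ltW. Qed.

Lemma mvar_ge0 (y : R) : 0 <= y -> 0 <= v y.
Proof.
move=> y0; apply: addr_ge0; apply: mulr_ge0 => //; [exact: sqr_ge0|exact: sqr_ge0|exact: powR_ge0].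
Qed.

(** The linear part of [v] has zero second difference; the power part is convex. *)
Lemma mvar_second_difference_ge0 (x a : R) : 0 <= a -> a <= x ->
  0 <= v (x + a) + v (x - a) - 2 * v x.
Proof.
move=> a0 ax.
have xa : 0 <= x + a by lra.
have xa' : 0 <= x - a by lra.
have := powR_midpoint p1 xa xa'; rewrite (_ : (_ + _) / 2 = x); last by field.
rewrite -subr_ge0 => /(mulr_ge0 (sqr_ge0 gamma)); rewrite /mvar; lra.
Qed.

(** The linear part of [v] contributes exactly the left-hand side. The power part is non-negative:
    by convexity the two outer terms exceed twice the power of [a], which is at least that of
    [x]. *)
Lemma mvar_second_difference_overlap (x a : R) : 0 <= x -> x <= a ->
  2 * sigma ^+ 2 * (a - x) <= v (x + a) + v (a - x) - 2 * v x.
Proof.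
move=> x0 xa.
have a0 : 0 <= a by lra.
have xa1 : 0 <= x + a by lra.
have xa2 : 0 <= a - x by lra.
have := powR_midpoint p1 xa1 xa2; rewrite (_ : (_ + _) / 2 = a); last by field.
have xa' : x `^ (2 * H) <= a `^ (2 * H) by rewrite ge0_ler_powR ?nnegrE//; have := p1; lra.
move=> mid; have := mulr_ge0 (sqr_ge0 gamma)
  (_ : 0 <= (x + a) `^ (2 * H) + (a - x) `^ (2 * H) - 2 * x `^ (2 * H)).
rewrite /mvar => /(_ _); lra.
Qed.

Lemma grid_L4 k : L4 P (X k).
Proof. exact: (mincr_L4 sigma gamma Wbm Vfbm (grid0 _) (grid0 _)). Qed.

Lemma grid_sqr k : E (fun w => X k w ^+ 2) = v A.
Proof.
by rewrite (mincr_sqr sigma gamma H0 Wbm Vfbm WV)// -mulrBl natrD addrAC subrr add0r ger0_norm// ltW.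
Qed.

(** Increments are stationary, so only the lag [j] matters. The intervals are disjoint when
    [L <= j], and the absolute value then opens as [j h - A]; otherwise they overlap. *)
Let cov_dist (j k : nat) : E (fun w => X k w * X (k + j)%N w) =
  (v (j%:R * h + A) + v `|j%:R * h - A| - 2 * v (j%:R * h)) / 2.
Proof.
rewrite (mincr_mul sigma gamma H0 Wbm Vfbm WV)//.
have j0 : 0 <= j%:R * h :> R by exact: grid0.
rewrite (_ : (k + j + L)%:R * h - k%:R * h = j%:R * h + A); last by rewrite /A !natrD; ring.
rewrite (_ : (k + j)%:R * h - (k + L)%:R * h = j%:R * h - A); last by rewrite /A !natrD; ring.
rewrite (_ : (k + j)%:R * h - k%:R * h = j%:R * h); last by rewrite natrD; ring.
rewrite (_ : (k + j + L)%:R * h - (k + L)%:R * h = j%:R * h); last by rewrite !natrD; ring.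
rewrite [`|_ + A|]ger0_norm ?addr_ge0 ?(ltW A0)//.
rewrite [`|j%:R * h|]ger0_norm//.
by field.
Qed.

Let K4 := 24 * (sigma ^+ 4 * A ^+ 2 + gamma ^+ 4 * (A `^ (2 * H)) ^+ 2).

Let grid_moment4 k : E (fun w => X k w ^+ 4) <= K4.
Proof.
have kL : k%:R * h <= (k + L)%:R * h :> R by rewrite ler_pM2r// ler_nat leq_addr.
have := mincr_moment4_le sigma gamma H0 Wbm Vfbm (grid0 k) kL.
by rewrite (_ : (k + L)%:R * h - k%:R * h = A)// /A natrD; ring.
Qed.

(** The first term serves disjoint increments. The second serves overlapping ones: their covariance
    is at least [sigma^2 h], so [K4] is at most [K4 / (sigma^2 h)] times it. *)
Let K := 2 * v A + K4 / (sigma ^+ 2 * h).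

Let K4_ge0 : 0 <= K4.
Proof. by rewrite mulr_ge0// addr_ge0// mulr_ge0 ?sqr_ge0 ?exprn_even_ge0. Qed.

Let sh0 : 0 < sigma ^+ 2 * h. Proof. by rewrite mulr_gt0// exprn_gt0. Qed.

Let K0 : 0 <= K.
Proof.
apply: addr_ge0; last by rewrite divr_ge0// ltW.
by rewrite mulr_ge0// mvar_ge0// ltW.
Qed.

Let cov_le_vA (j k : nat) : E (fun w => X k w * X (k + j)%N w) <= v A.
Proof.
apply: (le_trans (mean_mul_le (grid_L4 k) (grid_L4 (k + j)%N))).
by rewrite !grid_sqr; lra.
Qed.

Let cov_sqr_le (j k : nat) :
  E (fun w => X k w ^+ 2 * X (k + j)%N w ^+ 2) - v A ^+ 2 <=
  K * E (fun w => X k w * X (k + j)%N w).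
Proof.
have j0 : 0 <= j%:R * h :> R by exact: grid0.
have [Lj|jL] := leqP L j.
  have rho0 : 0 <= E (fun w => X k w * X (k + j)%N w).
    have Aj : A <= j%:R * h by rewrite ler_pM2r// ler_nat.
    rewrite cov_dist ger0_norm ?subr_ge0// divr_ge0//.
    exact: mvar_second_difference_ge0 (ltW A0) Aj.
  rewrite (mincr_disjoint sigma gamma H0 Wbm Vfbm WV)//; first last.
  - by rewrite -!mulrBl !natrD; ring.
  - by rewrite ler_pM2r// ler_nat leq_addr.
  - by rewrite ler_pM2r// ler_nat leq_add2l.
  - by rewrite ler_pM2r// ler_nat leq_addr.
  rewrite (_ : (k + L)%:R * h - k%:R * h = A); last by rewrite /A natrD; ring.
  have rho1 := cov_le_vA j k.
  have K4' : 0 <= K4 / (sigma ^+ 2 * h) by rewrite divr_ge0// ltW.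
  (* From [0 <= rho <= v A], the excess [2 rho^2] is at most [2 (v A) rho]. *)
  rewrite /K; move: rho0 rho1; rewrite /X; set rho := Rintegral _ _ _ => rho0 rho1.
  nra.
(* Here [j < L]: the two intervals share at least one grid step, that is [A - j h >= h]. *)
have rho1 : sigma ^+ 2 * h <= E (fun w => X k w * X (k + j)%N w).
  have jA : j%:R * h <= A by rewrite ler_pM2r// ler_nat ltnW.
  rewrite cov_dist distrC ger0_norm ?subr_ge0//.
  have := mvar_second_difference_overlap j0 jA.
  have : h <= A - j%:R * h.
    by rewrite /A -mulrBl -natrB ?(ltnW jL)// ler_peMl ?(ltW h0)// ler1n subn_gt0.
  have := sqr_ge0 sigma; nra.
have E4 : E (fun w => X k w ^+ 2 * X (k + j)%N w ^+ 2) <= K4.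
  have LX := grid_L4 k; have LY := grid_L4 (k + j)%N.
  pose l := [:: (2^-1 : R, fun w => X k w ^+ 4); (2^-1 : R, fun w => X (k + j)%N w ^+ 4)].
  have li : lincomb_integrable P l by do !split; [exact: LX.2|exact: LY.2].
  apply: (@le_trans _ _ (E (lincomb l))).
    apply: le_mean; [exact: L4_sqr_sqr|exact: integrable_lincomb|].
    by move=> w; rewrite /=; have := sqr_ge0 (X k w ^+ 2 - X (k + j)%N w ^+ 2); nra.
  rewrite (mean_lincomb li)/=.
  have := grid_moment4 k; have := grid_moment4 (k + j)%N; lra.
have rho0 : 0 < E (fun w => X k w * X (k + j)%N w) by exact: lt_le_trans rho1.
have : K4 <= K4 / (sigma ^+ 2 * h) * E (fun w => X k w * X (k + j)%N w).
  by rewrite mulrAC ler_pdivlMr// ler_wpM2l.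
have : 0 <= v A * E (fun w => X k w * X (k + j)%N w).
  by apply: mulr_ge0; [apply: mvar_ge0; exact: ltW|exact: ltW].
have := sqr_ge0 (v A); rewrite /K; lra.
Qed.

Let cov_sqr_le2 k l : E (fun w => X k w ^+ 2 * X l w ^+ 2) - v A ^+ 2 <=
  K * E (fun w => X k w * X l w).
Proof.
wlog kl : k l / (k <= l)%N => [hw|].
  have [kl|/ltnW lk] := leqP k l; first exact: hw.
  have := hw _ _ lk; under eq_Rintegral do rewrite mulrC.
  by under [in X in _ <= X]eq_Rintegral do rewrite mulrC.
by rewrite -(subnKC kl); exact: cov_sqr_le.
Qed.

Let C := L%:R ^+ 2 * (sigma ^+ 2 * h + gamma ^+ 2 * h `^ (2 * H)).

(** Both sides sum the unit increments [m (k + j + 1) - m (k + j)] over [k < n] and [j < L], grouped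
    by [k] on the left and by [j] on the right. *)
Lemma sum_lag_telescope (m : nat -> R) (n : nat) :
  \sum_(k < n) (m (k + L)%N - m k) = \sum_(j < L) (m (n + j)%N - m j).
Proof.
elim: (L) => [|l IH].
  by rewrite big_ord0 big1// => k _; rewrite addn0 subrr.
rewrite big_ord_recr/= -IH (eq_bigr (fun k : 'I_n => (m (k + l)%N - m k) +
  (m (k.+1 + l)%N - m (k + l)%N))); last first.
  by move=> k _; rewrite addnS addSn; ring.
rewrite big_split/=; congr (_ + _).
rewrite -(big_mkord xpredT (fun k => m (k.+1 + l)%N - m (k + l)%N)).
by rewrite (telescope_sumr (fun k => m (k + l)%N)).
Qed.

(** Telescoping replaces the [n] terms by [L] increments of span [n h]. Their [L^2] covariances are
    at most [v (n h)] each, which explains the shape of [C]. *)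
Let var_sum n : \int[P]_w ((\sum_(k < n) X k w) ^+ 2) <= C * n%:R `^ (2 * H).
Proof.
pose Y j : T -> R := M (j%:R * h) ((n + j)%:R * h).
have LY j : L4 P (Y j) by exact: (mincr_L4 sigma gamma Wbm Vfbm (grid0 _) (grid0 _)).
have EY j : E (fun w => Y j w ^+ 2) = v (n%:R * h).
  rewrite (mincr_sqr sigma gamma H0 Wbm Vfbm WV)// -mulrBl natrD addrK.
  by rewrite ger0_norm.
have -> : (fun w => (\sum_(k < n) X k w) ^+ 2) = (fun w => (\sum_(j < L) Y j w) ^+ 2).
  apply/funext => w; congr (_ ^+ 2).
  have := @sum_lag_telescope (fun k => sigma * W (k%:R * h) w + gamma * V (k%:R * h) w) n.
  move=> tel; transitivity (\sum_(k < n)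
     ((sigma * W ((k + L)%:R * h) w + gamma * V ((k + L)%:R * h) w)
      - (sigma * W (k%:R * h) w + gamma * V (k%:R * h) w))).
    by apply: eq_bigr => k _; rewrite /X /mincr /incr; ring.
  by rewrite tel; apply: eq_bigr => j _; rewrite /Y /mincr /incr; ring.
have iYY k l := L4_prod2 (LY k) (LY l).
have [_ ->] := mean_sqr_sum L iYY.
have le1 k l : E (fun w => Y k w * Y l w) <= v (n%:R * h).
  by apply: (le_trans (mean_mul_le (LY k) (LY l))); rewrite !EY; lra.
apply: (@le_trans _ _ (\sum_(k < L) \sum_(l < L) v (n%:R * h))).
  by apply: ler_sum => k _; apply: ler_sum => l _; exact: le1.
rewrite !sumr_const card_ord -mulrnA -[leLHS]mulr_natl natrM -expr2 /C -[leRHS]mulrA.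
rewrite ler_wpM2l ?sqr_ge0// /mvar powRM ?(ltW h0)//.
(* Since [2 H >= 1], the linear Brownian growth is absorbed by the fractional one. *)
have n2H : n%:R <= n%:R `^ (2 * H) :> R.
  case: n {Y LY EY iYY le1} => [|n]; first exact: powR_ge0.
  by rewrite -[leLHS]powRr1// ler_powR// ler1n.
have : sigma ^+ 2 * (n%:R * h) <= sigma ^+ 2 * (n%:R `^ (2 * H) * h).
  by rewrite ler_wpM2l ?sqr_ge0// ler_wpM2r// ltW.
lra.
Qed.

Let C0 : 0 <= C.
Proof.
apply: mulr_ge0; first exact: sqr_ge0.
by apply: addr_ge0; apply: mulr_ge0; [exact: sqr_ge0|exact: ltW|exact: sqr_ge0|exact: powR_ge0].
Qed.

Let a2 : 2 * H < 2. Proof. by move: H1; lra. Qed.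

Lemma grid_quadratic_slln : {ae P, forall w,
  n%:R^-1 * \sum_(0 <= k < n) M (k%:R * h) ((k + L)%:R * h) w ^+ 2 @[n --> \oo]
    --> v (L%:R * h)}.
Proof. exact: (quadratic_slln grid_L4 grid_sqr cov_sqr_le2 K0 C0 a2 var_sum). Qed.

Lemma grid_linear_slln : {ae P, forall w,
  n%:R^-1 * \sum_(0 <= k < n) M (k%:R * h) ((k + L)%:R * h) w @[n --> \oo]
    --> (0 : R)}.
Proof. exact: (linear_slln grid_L4 grid_sqr cov_sqr_le2 K0 C0 a2 var_sum). Qed.

End Grid.

(** * Averages along a path *)

Section Averages.
Context {R : realType}.
Implicit Types (a b : nat -> R) (c l : R).

Definition average a (n : nat) : R := n%:R^-1 * \sum_(0 <= k < n) a k.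

Lemma eq_average a b : a =1 b -> average a = average b.
Proof. by move=> ab; congr average; apply/funext. Qed.

Lemma cvg_average_cst c : average (fun=> c) @ \oo --> c.
Proof.
have L : (c : R) @[_ --> \oo] --> c by exact: cvg_cst.
apply: cvg_trans L; apply: near_eq_cvg; near=> n.
have n0 : n%:R != 0 :> R by rewrite pnatr_eq0 -lt0n; near: n; exact: nbhs_infty_gt.
by rewrite /average sumr_const_nat subn0 -[c *+ n]mulr_natl mulrA mulVf ?mul1r.
Unshelve. all: by end_near. Qed.

Lemma cvg_averageZ c a l : average a @ \oo --> l ->
  average (fun k => c * a k) @ \oo --> c * l.
Proof.
move=> al; have -> : average (fun k => c * a k) = (fun n => c * average a n).
  by apply/funext => n; rewrite /average -mulr_sumr mulrCA.
by apply: cvgM => //; exact: cvg_cst.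
Qed.

Lemma cvg_averageD a b l l' : average a @ \oo --> l -> average b @ \oo --> l' ->
  average (fun k => a k + b k) @ \oo --> l + l'.
Proof.
move=> al bl; have -> : average (fun k => a k + b k) = average a \+ average b.
  by apply/funext => n; rewrite /average /= big_split/= mulrDr.
exact: cvgD.
Qed.

(** For [n > 0] the shifted average is [(n+1) / n] times the average of [a] at [n + 1], minus
    [a 0 / n]. *)
Lemma cvg_average_shiftS a l : average a @ \oo --> l ->
  average (fun k => a k.+1) @ \oo --> l.
Proof.
move=> al.
have L : ((n.+1)%:R / n%:R * average a n.+1 - n%:R^-1 * a 0%N) @[n --> \oo] --> l.
  have Vn : (n%:R^-1 : R) @[n --> \oo] --> (0 : R).
    by rewrite -(cvg_shiftS (fun n => n%:R^-1 : R)); exact: cvg_harmonic.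
  have ratio : ((n.+1)%:R / n%:R : R) @[n --> \oo] --> (1 : R).
    have L : (1 + n%:R^-1 : R) @[n --> \oo] --> (1 + 0 : R).
      by apply: cvgD => //; exact: cvg_cst.
    rewrite addr0 in L; apply: cvg_trans L; apply: near_eq_cvg; near=> n.
    have n0 : n%:R != 0 :> R by rewrite pnatr_eq0 -lt0n; near: n; exact: nbhs_infty_gt.
    by rewrite -natr1; field.
  have -> : l = 1 * l - 0 * a 0%N by rewrite mul1r mul0r subr0.
  apply: cvgB; last by apply: cvgM => //; exact: cvg_cst.
  by apply: cvgM => //; move: al; rewrite -(cvg_shiftS (average a)).
apply: cvg_trans L; apply: near_eq_cvg; near=> n.
have n0 : n%:R != 0 :> R by rewrite pnatr_eq0 -lt0n; near: n; exact: nbhs_infty_gt.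
rewrite /average big_nat_recl//=.
have n1 : n.+1%:R != 0 :> R by rewrite pnatr_eq0.
by field; apply/andP.
Unshelve. all: by end_near. Qed.

Lemma cvg_average_shift j a l : average a @ \oo --> l ->
  average (fun k => a (k + j)%N) @ \oo --> l.
Proof.
move=> al; elim: j => [|j IH].
  by rewrite (@eq_average _ a)// => k; rewrite addn0.
have := cvg_average_shiftS IH.
by rewrite (@eq_average _ (fun k => a (k + j.+1)%N))// => k; rewrite addSnnS.
Qed.

(** * Deterministic limits of the statistics along one path *)

Section Path.
Variables (h theta : R) (m v : R -> R).
Hypothesis h0 : 0 < h.
Let D (L k : nat) := m ((k + L)%:R * h) - m (k%:R * h).
Hypothesis D1 : forall L, (0 < L)%N -> average (D L) @ \oo --> (0 : R).
Hypothesis D2 : forall L, (0 < L)%N -> average (fun k => D L k ^+ 2) @ \oo --> v (L%:R * h).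
Let y t := theta * t + m t.

Let cvg_average_affine (L : nat) c : (0 < L)%N ->
  average (fun k => c + D L k) @ \oo --> c.
Proof.
move=> L0; rewrite -[X in _ --> X]addr0.
by apply: cvg_averageD; [exact: cvg_average_cst|exact: D1].
Qed.

Lemma cvg_theta_hat : theta_hat h n y @[n --> \oo] --> theta.
Proof.
have -> : (fun n => theta_hat h n y) = (fun n => h^-1 * average (fun k => theta * h + D 1 k) n).
  apply/funext => n; rewrite /theta_hat /average mulrA -invfM [h * _]mulrC; congr (_ * _).
  by apply: eq_bigr => k _; rewrite /increment /y /D addn1 -natr1; ring.
have {2}-> : theta = h^-1 * (theta * h) by field; rewrite gt_eqF.
by apply: cvgM; [exact: cvg_cst|exact: cvg_average_affine].
Qed.

Lemma cvg_xi : xi h n y @[n --> \oo] --> theta ^+ 2 * h ^+ 2 + v h.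
Proof.
have -> : (fun n => xi h n y) = average (fun k => (theta * h) ^+ 2 +
    ((2 * theta * h) * D 1 k + D 1 k ^+ 2)).
  apply/funext => n; congr (_ * _); apply: eq_bigr => k _.
  by rewrite /increment /y /D addn1 -natr1; ring.
have -> : theta ^+ 2 * h ^+ 2 + v h = (theta * h) ^+ 2 + ((2 * theta * h) * 0 + v (1%:R * h)).
  by rewrite mul1r; ring.
apply: cvg_averageD; first exact: cvg_average_cst.
by apply: cvg_averageD; [apply: cvg_averageZ; exact: D1|exact: D2].
Qed.

(** The adjacent increments [D L k] and [D L (k + L)] add up to [D (L + L) k], so polarization
    leaves only squares, whose averages converge by [D2]; terms linear in [D] average to 0. The case
    [L = 1] serves [eta], the case [L = 2] serves [zeta]. *)
Lemma cvg_average_lag_product L c : (0 < L)%N ->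
  average (fun k => (c + D L k) * (c + D L (k + L)%N)) @ \oo -->
  c ^+ 2 + (v ((L + L)%:R * h) - 2 * v (L%:R * h)) / 2.
Proof.
move=> L0.
rewrite (@eq_average _ (fun k => c ^+ 2 + (c * D L k + (c * D L (k + L)%N +
    (2^-1 * D (L + L) k ^+ 2 + (- 2^-1 * D L k ^+ 2 + - 2^-1 * D L (k + L)%N ^+ 2)))))); last first.
  by move=> k; rewrite /D addnA; field.
have -> : c ^+ 2 + (v ((L + L)%:R * h) - 2 * v (L%:R * h)) / 2 =
    c ^+ 2 + (c * 0 + (c * 0 + (2^-1 * v ((L + L)%:R * h) +
    (- 2^-1 * v (L%:R * h) + - 2^-1 * v (L%:R * h))))) by field.
have LL : (0 < L + L)%N by rewrite addn_gt0 L0.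
apply: cvg_averageD; first exact: cvg_average_cst.
apply: cvg_averageD; first by apply: cvg_averageZ; exact: D1.
apply: cvg_averageD; first by apply: cvg_averageZ; apply: (cvg_average_shift L); exact: D1.
apply: cvg_averageD; first by apply: cvg_averageZ; exact: D2.
apply: cvg_averageD; first by apply: cvg_averageZ; exact: D2.
by apply: cvg_averageZ; apply: (@cvg_average_shift L (fun k => D L k ^+ 2)); exact: D2.
Qed.

Lemma cvg_eta : eta h n y @[n --> \oo] -->
  theta ^+ 2 * h ^+ 2 + (v (2 * h) - 2 * v h) / 2.
Proof.
have -> : (fun n => eta h n y) =
    average (fun k => (theta * h + D 1 k) * (theta * h + D 1 (k + 1)%N)).
  apply/funext => n; congr (_ * _); apply: eq_bigr => k _.
  by rewrite /increment /y /D !addn1 -[k.+2%:R]natr1 -[k.+1%:R]natr1; ring.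
have := @cvg_average_lag_product 1 (theta * h) isT.
by rewrite exprMn mul1r.
Qed.

Lemma cvg_zeta : zeta h n y @[n --> \oo] -->
  4 * theta ^+ 2 * h ^+ 2 + (v (4 * h) - 2 * v (2 * h)) / 2.
Proof.
have -> : (fun n => zeta h n y) =
    average (fun k => (2 * theta * h + D 2 k) * (2 * theta * h + D 2 (k + 2)%N)).
  apply/funext => n; congr (_ * _); apply: eq_bigr => k _.
  rewrite /y /D -addnA !addn2 addn4 -[k.+4%:R]natr1 -[k.+3%:R]natr1 -[k.+2%:R]natr1 -[k.+1%:R]natr1.
  by ring.
have -> : 4 * theta ^+ 2 * h ^+ 2 = (2 * theta * h) ^+ 2 by ring.
exact: (@cvg_average_lag_product 2 (2 * theta * h) isT).
Qed.

End Path.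

Lemma cvg_subject_mean N (f : nat -> nat -> R) (l : nat -> R) :
  (forall i, f n i @[n --> \oo] --> l i) ->
  subject_mean N (f n) @[n --> \oo] --> subject_mean N l.
Proof.
move=> fl; apply: cvgM; first exact: cvg_cst.
elim: N => [|N IH].
  have -> : (fun n => \sum_(0 <= i < 0) f n i) = fun=> 0.
    by apply/funext => n; rewrite big_geq.
  by rewrite big_geq//; exact: cvg_cst.
have -> : (fun n => \sum_(0 <= i < N.+1) f n i) =
    (fun n => \sum_(0 <= i < N) f n i + f n N).
  by apply/funext => n; rewrite big_nat_recr.
by rewrite big_nat_recr//=; apply: cvgD => //; exact: fl.
Qed.

Lemma subject_mean_affine N (f : nat -> R) (a c : R) : (0 < N)%N ->
  subject_mean N (fun i => a * f i + c) = a * subject_mean N f + c.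
Proof.
move=> N0; rewrite /subject_mean big_split/= -mulr_sumr sumr_const_nat subn0.
have N0' : N%:R != 0 :> R by rewrite pnatr_eq0 -lt0n.
by rewrite -mulr_natl; field.
Qed.

Lemma cvg_powR_exponent (b : R) (f : nat -> R) l : 0 < b ->
  f @ \oo --> l -> b `^ f n @[n --> \oo] --> b `^ l.
Proof.
move=> b0 fl; rewrite /powR gt_eqF//.
apply: (cvg_comp (fun n => f n * ln b) expR); last exact: continuous_expR.
by apply: cvgM => //; exact: cvg_cst.
Qed.

(** As [l] is positive, the truncation in [log2_plus] is eventually inactive. *)
Lemma cvg_log2_plus (f : nat -> R) l : 0 < l -> f @ \oo --> l ->
  log2_plus (f n) @[n --> \oo] --> ln l / ln 2.
Proof.
move=> l0 fl.
have L : ln (f n) / ln 2 @[n --> \oo] --> ln l / ln 2.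
  apply: cvgM; last exact: cvg_cst.
  exact: (cvg_comp _ _ fl (continuous_ln l0)).
apply: cvg_trans L; apply: near_eq_cvg; near=> n.
rewrite /log2_plus ifT//; near: n.
exact: (cvgr_gt l fl).
Unshelve. all: by end_near. Qed.

End Averages.

(** * Consistency *)

Section Estimator.
Context {R : realType}.
Variables (sigma gamma H h : R).
Hypotheses (gamma0 : 0 < gamma) (H12 : 1 / 2 < H) (h0 : 0 < h).

Local Notation v := (mvar sigma gamma H).

(** Doubling cancels the linear Brownian part of [v] and isolates the fractional part. *)
Lemma mvar_double y : 0 <= y ->
  (v (2 * y) - 2 * v y) / 2 = gamma ^+ 2 * y `^ (2 * H) * (2 `^ (2 * H - 1) - 1).
Proof.
move=> y0; rewrite /mvar powRM//.
have -> : 2 `^ (2 * H) = 2 * 2 `^ (2 * H - 1) :> R.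
  rewrite -{1}(subrKC 1 (2 * H)) powRD ?powRr1//.
  by rewrite pnatr_eq0 implybT.
by field.
Qed.

(** The exponent is positive because [H > 1/2]; this keeps the limits of the denominators away from
    0. *)
Let gap_gt0 : 0 < 2 `^ (2 * H - 1) - 1 :> R.
Proof.
have one : 1 `^ (2 * H - 1) = 1 :> R by rewrite powR1.
rewrite subr_gt0 -[ltLHS]one.
by apply: gt0_ltr_powR; rewrite ?nnegrE ?ltr1n//; move: H12; lra.
Qed.

(** In the limit the drifts enter only through [Vl], the mean of their squares, and the corrections
    by [V_bar] cancel it. The corrected [xi_bar], [eta_bar] and [zeta_bar] tend to [v h], [g] and
    [2^(2H) g], and each estimator is continuous at these values. *)
Lemma cvg_Theta_hat (y : nat -> R -> R) (theta : nat -> R) N : (0 < N)%N ->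
  (forall i, theta_hat h n (y i) @[n --> \oo] --> theta i) ->
  (forall i, xi h n (y i) @[n --> \oo] --> theta i ^+ 2 * h ^+ 2 + v h) ->
  (forall i, eta h n (y i) @[n --> \oo] -->
     theta i ^+ 2 * h ^+ 2 + (v (2 * h) - 2 * v h) / 2) ->
  (forall i, zeta h n (y i) @[n --> \oo] -->
     4 * theta i ^+ 2 * h ^+ 2 + (v (4 * h) - 2 * v (2 * h)) / 2) ->
  Theta_hat h y n N @[n --> \oo] --> (H, gamma ^+ 2, sigma ^+ 2).
Proof.
move=> N0 Lth Lxi Leta Lzeta.
pose Vl := subject_mean N (fun i => theta i ^+ 2).
have LV : V_bar h y n N @[n --> \oo] --> Vl.
  by apply: cvg_subject_mean => i; apply: cvgM; exact: Lth.
have mean_affine a c : subject_mean N (fun i => a * theta i ^+ 2 + c) = a * Vl + c.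
  exact: subject_mean_affine.
have L1 : xi_bar h y n N - h ^+ 2 * V_bar h y n N @[n --> \oo] --> v h.
  have -> : v h = subject_mean N (fun i => theta i ^+ 2 * h ^+ 2 + v h) - h ^+ 2 * Vl.
    under eq_fun do rewrite mulrC.
    by rewrite mean_affine addrAC subrr add0r.
  by apply: cvgB; [exact: cvg_subject_mean|apply: cvgM => //; exact: cvg_cst].
(* [g] is [gamma^2] times the value at [H] of the denominator of [gamma2_hat]. *)
pose g := gamma ^+ 2 * h `^ (2 * H) * (2 `^ (2 * H - 1) - 1).
have L2 : eta_bar h y n N - h ^+ 2 * V_bar h y n N @[n --> \oo] --> g.
  have -> : g = subject_mean N (fun i => theta i ^+ 2 * h ^+ 2 + (v (2 * h) - 2 * v h) / 2)
      - h ^+ 2 * Vl.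
    rewrite mvar_double ?ltW//; under eq_fun do rewrite mulrC.
    by rewrite mean_affine addrAC subrr add0r.
  by apply: cvgB; [exact: cvg_subject_mean|apply: cvgM => //; exact: cvg_cst].
have L4 : zeta_bar h y n N - 4 * h ^+ 2 * V_bar h y n N @[n --> \oo] --> 2 `^ (2 * H) * g.
  have -> : 2 `^ (2 * H) * g =
      subject_mean N (fun i => 4 * theta i ^+ 2 * h ^+ 2 + (v (4 * h) - 2 * v (2 * h)) / 2)
      - 4 * h ^+ 2 * Vl.
    rewrite (_ : 4 * h = 2 * (2 * h)); last by ring.
    rewrite mvar_double ?mulr_ge0 ?ltW// powRM ?(ltW h0)//.
    under eq_fun do rewrite mulrAC.
    by rewrite mean_affine /g; ring.
  by apply: cvgB; [exact: cvg_subject_mean|apply: cvgM => //; exact: cvg_cst].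
have hH0 : 0 < h `^ (2 * H) by rewrite powR_gt0.
have g0 : 0 < g by rewrite /g !mulr_gt0 ?exprn_gt0.
have LH : H_hat h y n N @[n --> \oo] --> H.
  have Lr : (zeta_bar h y n N - 4 * h ^+ 2 * V_bar h y n N) /
      (eta_bar h y n N - h ^+ 2 * V_bar h y n N) @[n --> \oo] --> 2 `^ (2 * H).
    rewrite -[X in _ --> X](mulfK (lt0r_neq0 g0)).
    by apply: cvgM => //; apply: cvgV => //; rewrite gt_eqF.
  have pow0 : 0 < 2 `^ (2 * H) :> R by rewrite powR_gt0.
  rewrite [X in _ --> X](_ : H = 2^-1 * (ln (2 `^ (2 * H)) / ln 2)); last first.
    by rewrite ln_powR mulfK ?gt_eqF ?ln_gt0 ?ltr1n//; field.
  by apply: cvgM; [exact: cvg_cst|exact: (cvg_log2_plus pow0 Lr)].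
have L2H : 2 * H_hat h y n N @[n --> \oo] --> 2 * H by apply: cvgM => //; exact: cvg_cst.
have LhH := cvg_powR_exponent h0 L2H.
have L2H1 : 2 * H_hat h y n N - 1 @[n --> \oo] --> 2 * H - 1.
  by apply: cvgB => //; exact: cvg_cst.
have L22 : 2 `^ (2 * H_hat h y n N - 1) @[n --> \oo] --> 2 `^ (2 * H - 1).
  exact: cvg_powR_exponent.
have Lgamma : gamma2_hat h y n N @[n --> \oo] --> gamma ^+ 2.
  have -> : gamma ^+ 2 = g / (h `^ (2 * H) * (2 `^ (2 * H - 1) - 1)).
    by rewrite /g; field; rewrite !gt_eqF.
  apply: cvgM => //; apply: cvgV; first by rewrite gt_eqF// mulr_gt0.
  by apply: cvgM => //; apply: cvgB => //; exact: cvg_cst.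
have Lsigma : sigma2_hat h y n N @[n --> \oo] --> sigma ^+ 2.
  have -> : sigma ^+ 2 = (v h - gamma ^+ 2 * h `^ (2 * H)) / h.
    by rewrite /mvar; field; rewrite gt_eqF.
  apply: cvgM; last exact: cvg_cst.
  by apply: cvgB => //; apply: cvgM.
exact: (cvg_pair (cvg_pair LH Lgamma) Lsigma).
Qed.

End Estimator.

Theorem proposition4 (d : measure_display) (T : measurableType d)
  (R : realType) (P : probability T R)
  (sigma gamma H h : R)
  (sigma_gt0 : 0 < sigma) (gamma_gt0 : 0 < gamma)
  (H_gt : 1 / 2 < H) (H_lt : H < 1) (h_gt0 : 0 < h)
  (B BH : nat -> R -> {RV P >-> R}) (phi : nat -> {RV P >-> R})
  (B_bm : forall i, standard_brownian_motion (B i))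
  (BH_fbm : forall i, fractional_brownian_motion H (BH i))
  (noise_indep : mutually_independent P
     (fun j : (nat + nat)%type =>
        sigma_generated [set t : R | 0 <= t] (driving_noise B BH j)))
  (phi_indep : mutually_independent_rv P (fun i => phi i : T -> R))
  (phi_id : identically_distributed phi)
  (phi_noise_indep : independent P
     (sigma_generated setT (fun i => phi i : T -> R))
     (sigma_generated [set it : nat * R | 0 <= it.2]
        (fun it => mixed_fbm sigma gamma B BH it.1 it.2)))
  (phi_moment4 : forall i, ('E_P[(fun w => phi i w ^+ 4)%R] < +oo)%E) :
  {ae P, forall w,
    sequential_limit
      (fun n N =>
         Theta_hat h (fun i t => observation sigma gamma phi B BH i t w) n N)
      (H, gamma ^+ 2, sigma ^+ 2)}.
Proof.
have BBH i : independent P (sigma_generated [set t : R | 0 <= t] (B i))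
    (sigma_generated [set t : R | 0 <= t] (BH i)).
  move=> A1 A2 mA1 mA2.
  (* Mutual independence is applied to the two indices [inl i] and [inr i] only. *)
  pose A (j : (nat + nat)%type) := if j is inl _ then A1 else A2.
  have := noise_indep [:: inl i; inr i] A isT.
  rewrite !big_cons big_nil mule1 => <-.
    congr (P _); rewrite eqEsubset; split => [w [w1 w2] k /=|w wA].
      by rewrite !inE => /orP[] /eqP ->.
    by split; [apply: (wA (inl i))|apply: (wA (inr i))]; rewrite /= !inE eqxx ?orbT.
  by move=> j; rewrite !inE => /orP[] /eqP ->.
(* The lag is [L.+1], so that [L] ranging over all naturals covers exactly the positive lags. As
   subjects and lags are countable, one null set serves them all. *)
pose D i L k w := mincr sigma gamma (B i) (BH i) (k%:R * h) ((k + L.+1)%:R * h) w.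
have slln1 : {ae P, forall w, forall i L, average (fun k => D i L k w) @ \oo --> (0 : R)}.
  apply: ae_foralln => i; apply: ae_foralln => L.
  exact: (grid_linear_slln _ sigma_gt0 H_gt H_lt h_gt0 (B_bm i) (BH_fbm i) (BBH i)).
have slln2 : {ae P, forall w, forall i L, average (fun k => D i L k w ^+ 2) @ \oo -->
    mvar sigma gamma H (L.+1%:R * h)}.
  apply: ae_foralln => i; apply: ae_foralln => L.
  exact: (grid_quadratic_slln _ sigma_gt0 H_gt H_lt h_gt0 (B_bm i) (BH_fbm i) (BBH i)).
apply: filterS2 slln1 slln2 => w D1 D2.
(* For every [N > 0] the inner limit is the true parameter, so the outer limit is that of a constant
   sequence. *)
exists (fun=> (H, gamma ^+ 2, sigma ^+ 2)); split; last exact: cvg_cst.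
move=> N N0.
pose m i t := mixed_fbm sigma gamma B BH i t w.
have DE i L k : (0 < L)%N -> D i L.-1 k w = m i ((k + L)%:R * h) - m i (k%:R * h).
  by move=> L0; rewrite /D /m /mixed_fbm /mincr /incr prednK//; ring.
have D1' i L : (0 < L)%N ->
    average (fun k => m i ((k + L)%:R * h) - m i (k%:R * h)) @ \oo --> (0 : R).
  move=> L0; have := D1 i L.-1.
  by rewrite (@eq_average _ _ (fun k => m i ((k + L)%:R * h) - m i (k%:R * h)))// => k; rewrite DE.
have D2' i L : (0 < L)%N ->
    average (fun k => (m i ((k + L)%:R * h) - m i (k%:R * h)) ^+ 2) @ \oo -->
    mvar sigma gamma H (L%:R * h).
  move=> L0; have := D2 i L.-1; rewrite prednK//.
  by rewrite (@eq_average _ _ (fun k => (m i ((k + L)%:R * h) - m i (k%:R * h)) ^+ 2))// => k;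
    rewrite DE.
apply: (@cvg_Theta_hat R sigma gamma H h gamma_gt0 H_gt h_gt0 _
  (fun i => random_drift sigma phi i w)) => // i.
- exact: (cvg_theta_hat (m := m i) h_gt0 (D1' i)).
- exact: (cvg_xi (m := m i) (D1' i) (D2' i)).
- exact: (cvg_eta (m := m i) (D1' i) (D2' i)).
- exact: (cvg_zeta (m := m i) (D1' i) (D2' i)).
Qed.
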